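(* Let $K$ be an algebraically closed field complete with respect to a nontrivial nonarchimedean absolute value, let $\varphi:\mathbb{P}^N_K\to\mathbb{P}^N_K$ be a morphism of degree $d\ge2$, let $\Phi$ be a lift of $\varphi$, and let $\hat g_\Phi:\mathbb{P}^N(K)\to\mathbb{R}$ be the modified Green function. Let $u=\max\{2d,\ |\operatorname{Res}(\varphi)|^{-2}\}$. Then for all $P,Q\in\mathbb{P}^N(K)$, $$|\hat g_\Phi(P)-\hat g_\Phi(Q)|\le\frac{2u\log u}{d}\,\Delta(P,Q)^{\frac{\log d}{\log u}}.$$ In particular $\hat g_\Phi$ is Hölder continuous.
   Context: For $x\in K^{N+1}$, $\|x\|=\max_i|x_i|$, and $\pi:K^{N+1}\setminus\{0\}\to\mathbb{P}^N(K)$ is the projection. The chordal distance of $P=\pi(x)$, $Q=\pi(y)$ is $\Delta(P,Q)=\max_{i,j}|x_iy_j-x_jy_i|/(\|x\|\,\|y\|)$. A lift of $\varphi$ is a tuple $\Phi=(\Phi_0,\dots,\Phi_N)$ of degree-$d$ homogeneous polynomials over $K$ with no common nontrivial zero and $\varphi\circ\pi=\pi\circ\Phi$; $\|\Phi\|$ is the maximum absolute value of its coefficients, and $\Phi$ is minimal if $\|\Phi\|=1$. $\operatorname{Res}(\varphi)$ is the Macaulay resultant of a minimal lift ($|\operatorname{Res}(\varphi)|$ is well defined, $0<|\operatorname{Res}(\varphi)|\le1$). The Green function is $G_\Phi(x)=\lim_{n\to\infty}d^{-n}\log\|\Phi^n(x)\|$ (the limit exists) and $\hat g_\Phi(P)=G_\Phi(x)-\log\|x\|$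 for $x\in\pi^{-1}(P)$. *)

(* Defs.v *)
From Stdlib Require Import Reals.
From HB Require Import structures.
From mathcomp Require Import all_boot all_order all_algebra.
From mathcomp Require Import algC.
From mathcomp Require Import mpoly.
Open Scope R_scope.

Set Implicit Arguments.
Unset Strict Implicit.
Unset Printing Implicit Defensive.

Import GRing.Theory.

Definition nonarch_abs (K : fieldType) (abs : K -> R) : Prop :=
  (forall x : K, 0 <= abs x) /\
  (forall x : K, abs x = 0 <-> x = 0%R) /\
  (forall x y : K, abs (x * y)%R = abs x * abs y) /\
  (forall x y : K, abs (x + y)%R <= Rmax (abs x) (abs y)).

Definition nontrivial_abs (K : fieldType) (abs : K -> R) : Prop :=
  exists x : K, abs x <> 0 /\ abs x <> 1.

Definition complete_abs (K : fieldType) (abs : K -> R) : Prop :=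
  forall u : nat -> K,
    (forall e : R, 0 < e -> exists M : nat, forall m n : nat,
        (M <= m)%coq_nat -> (M <= n)%coq_nat -> abs (u m - u n)%R < e) ->
    exists l : K, forall e : R, 0 < e -> exists M : nat, forall n : nat,
        (M <= n)%coq_nat -> abs (u n - l)%R < e.

Definition vec (K : Type) (N : nat) := 'I_N.+1 -> K.

Definition nonzero_vec (K : ringType) (N : nat) (x : vec K N) : Prop :=
  exists i, x i != 0%R.

Definition vnorm (K : ringType) (abs : K -> R) (N : nat) (x : vec K N) : R :=
  foldr Rmax 0 (map (fun i => abs (x i)) (enum 'I_N.+1)).

Definition chordal (K : ringType) (abs : K -> R) (N : nat) (x y : vec K N) : R :=
  (foldr Rmax 0
     (map (fun ij : 'I_N.+1 * 'I_N.+1 =>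
             abs (x ij.1 * y ij.2 - x ij.2 * y ij.1)%R)
          (enum {: 'I_N.+1 * 'I_N.+1}))
   / (vnorm abs x * vnorm abs y)).

Definition mon (N d : nat) :=
  {m : {ffun 'I_N.+1 -> 'I_d.+1} | \sum_(i < N.+1) (m i : nat) == d}.

(* an (N+1)-tuple of homogeneous polynomials of degree d, given by its
   coefficients: H i m is the coefficient of x^m in H_i *)
Definition hmap (K : Type) (N d : nat) := 'I_N.+1 -> mon N d -> K.

Definition heval (K : comRingType) (N d : nat) (H : hmap K N d) (x : vec K N)
  : vec K N :=
  fun i => (\sum_(m : mon N d) H i m * \prod_(j < N.+1) x j ^+ (val m j : nat))%R.

Definition no_common_zero (K : comRingType) (N d : nat) (H : hmap K N d) : Prop :=
  forall x : vec K N, nonzero_vec x -> nonzero_vec (heval H x).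

Definition hnorm (K : ringType) (abs : K -> R) (N d : nat) (H : hmap K N d) : R :=
  foldr Rmax 0
    (map (fun im : 'I_N.+1 * mon N d => abs (H im.1 im.2))
         (enum {: 'I_N.+1 * mon N d})).

Definition same_proj (K : fieldType) (N : nat) (x y : vec K N) : Prop :=
  exists c : K, c != 0%R /\ forall i, x i = (c * y i)%R.

(* Psi is a lift of the morphism phi induced by the lift Phi:
   Psi is a tuple of degree-d forms without common nontrivial zero with
   phi o pi = pi o Psi *)
Definition is_lift_of (K : fieldType) (N d : nat) (Phi Psi : hmap K N d) : Prop :=
  no_common_zero Psi /\
  forall x : vec K N, nonzero_vec x -> same_proj (heval Psi x) (heval Phi x).

Definition is_minimal_lift (K : fieldType) (abs : K -> R) (N d : nat)
  (Phi Psi : hmap K N d) : Prop :=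
  is_lift_of Phi Psi /\ hnorm abs Psi = 1.

(* universal coefficients: one variable per (i, m), numbered via enum_val *)
Definition ncoef (N d : nat) : nat := #|{: 'I_N.+1 * mon N d}|.

Definition coefvec (K : Type) (N d : nat) (H : hmap K N d) : 'I_(ncoef N d) -> K :=
  fun k => let im := enum_val k in H im.1 im.2.

Definition mirreducible (n : nat) (p : {mpoly int[n]}) : Prop :=
  p != 0%R /\ p \isn't a GRing.unit /\
  forall q r : {mpoly int[n]}, p = (q * r)%R ->
    q \is a GRing.unit \/ r \is a GRing.unit.

(* the standard system x_0^d, ..., x_N^d *)
Definition std_system (K : ringType) (N d : nat) : hmap K N d :=
  fun i m => if (val m i : nat) == d then 1%R else 0%R.

(* Rz is the Macaulay resultant of N+1 forms of degree d in N+1 variables: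
   the irreducible integer polynomial in the universal coefficients which
   vanishes (over an algebraically closed field of characteristic 0) exactly
   at the systems having a common nontrivial zero, normalized by
   Res(x_0^d, ..., x_N^d) = 1. *)
Definition is_macaulay_resultant (N d : nat) (Rz : {mpoly int[ncoef N d]}) : Prop :=
  mirreducible Rz /\
  Rz.@[coefvec (@std_system int N d)] = 1%R /\
  forall H : hmap algC N d,
    ((map_mpoly (fun z : int => (z%:~R)%R : algC) Rz).@[coefvec H] = 0%R <->
     exists z : vec algC N, nonzero_vec z /\ forall i, heval H z i = 0%R).

Definition res_of (K : ringType) (N d : nat) (Rz : {mpoly int[ncoef N d]})
  (H : hmap K N d) : K :=
  (map_mpoly (fun z : int => (z%:~R)%R : K) Rz).@[coefvec H].

Definition rpow (a b : R) : R := if Req_EM_T a 0 then 0 else Rpower a b.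

(* Main.v *)
(* Let r = |Res(phi)| and let Psi be the minimal lift.

   For |x| = 1, say x_i = 1, change the coefficient of x_i^d in each Psi_j by
   Psi_j(x): the new system vanishes at x, so its resultant is 0.  Over the
   complex algebraic numbers this is the defining property of the resultant;
   being an identity between integer polynomials, it holds over K.  Integer
   polynomials are 1-Lipschitz on the unit ball, so r <= |Psi(x)|, and hence
   r |x|^d <= |Psi(x)| <= |x|^d in general.

   That r is not 0, even in positive characteristic, comes from Macaulay
   matrices: their maximal minors vanish wherever the resultant does over the
   complex algebraic numbers, so the resultant divides a power of each of them
   along every line through the standard system, over Z; and some minor is
   nonzero by the projective Nullstellensatz.  The latter has a short proof
   here because a complete K is uncountable.

   Put tau(x) = log |Psi(x)| / d - log |x|.  The bounds above give
   |tau| <= - log r / d, tau(x) = tau(y) as soon as Delta(x, y) < r, and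
   Delta(phi x, phi y) <= r^-2 Delta(x, y).  So in the series
   sum_n d^-n (tau(phi^n x) - tau(phi^n y)) the terms vanish until
   r^-2n Delta(x, y) reaches r. *)

Require Import Defs.
From Stdlib Require Import Reals Lra Classical ClassicalEpsilon.
From HB Require Import structures.
From mathcomp Require Import all_boot all_order all_algebra.
From mathcomp Require Import algC mpoly.
Open Scope R_scope.

Set Implicit Arguments.
Unset Strict Implicit.
Unset Printing Implicit Defensive.

Import GRing.Theory Num.Theory.

(** * Integer polynomials evaluated in commutative rings *)

Section IntegerPolynomials.

Local Open Scope ring_scope.

(** Evaluation by [mmap intr] commutes with every ring morphism, so identities can travel between
    [algC], polynomial rings and [K]. *)
Definition ev (n : nat) (S : comRingType) (c : 'I_n -> S) (p : {mpoly int[n]}) : S :=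
  mmap intr c p.

Lemma ev_morph n (S T : comRingType) (f : {rmorphism S -> T}) (c : 'I_n -> S) p :
  f (ev c p) = ev (fun i => f (c i)) p.
Proof.
rewrite /ev /mmap rmorph_sum; apply: eq_bigr => m _.
rewrite rmorphM /= rmorph_int; congr (_ * _).
by rewrite /mmap1 rmorph_prod; apply: eq_bigr => i _; rewrite rmorphXn.
Qed.

Lemma ev_ext n (S : comRingType) (c c' : 'I_n -> S) p : c =1 c' -> ev c p = ev c' p.
Proof.
move=> e; rewrite /ev /mmap; apply: eq_bigr => m _; congr (_ * _).
by rewrite /mmap1; apply: eq_bigr => i _; rewrite e.
Qed.

Lemma ev_map_mpoly n (S : comRingType) (c : 'I_n -> S) p :
  (map_mpoly (fun z : int => z%:~R : S) p).@[c] = ev c p.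
Proof.
change ((map_mpoly (intmul (1 : S)) p).@[c] = ev c p).
rewrite [in LHS](mpolyE p) (raddf_sum (map_mpoly (intmul (1 : S)))) /=.
rewrite (raddf_sum (meval c)) /=; apply: eq_bigr => m _.
by rewrite map_mpolyZ mevalZ map_mpolyX mevalX.
Qed.

(** Reducing modulo [B] gives the lowest digit, which is then cancelled before dividing by [B]. In
    Kronecker's substitution this keeps distinct monomials distinct. *)
Lemma digit_sum_inj (B n : nat) (f g : nat -> nat) :
  (forall i, f i < B)%N -> (forall i, g i < B)%N ->
  (\sum_(i < n) f i * B ^ i = \sum_(i < n) g i * B ^ i)%N ->
  forall i, (i < n)%N -> f i = g i.
Proof.
elim: n f g => [|n IH] f g fB gB //.
have split_low (h : nat -> nat) :
    (\sum_(i < n.+1) h i * B ^ i = h 0 + (\sum_(i < n) h i.+1 * B ^ i) * B)%N.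
  rewrite big_ord_recl expn0 muln1 big_distrl /=; congr (_ + _)%N.
  by apply: eq_bigr => i _; rewrite /= expnSr mulnA.
have B0 : (0 < B)%N by apply: leq_ltn_trans (fB 0%N).
rewrite !split_low => e.
have e0 : f 0%N = g 0%N.
  by have := congr1 (modn^~ B) e; rewrite /= !(addnC _ (_ * B)%N) !modnMDl !modn_small.
move: e; rewrite e0 => /addnI /eqP; rewrite eqn_pmul2r // => /eqP e.
by move=> [|i] //= lin; apply: (IH (fun i => f i.+1) (fun i => g i.+1)).
Qed.

Lemma poly_eq0_of_nat_roots (F : numFieldType) (g : {poly F}) :
  (forall t : nat, g.[t%:R] = 0) -> g = 0.
Proof.
move=> h; apply/eqP/negPn/negP => g0.
have := @max_poly_roots _ g (map (fun t : nat => t%:R) (iota 0 (size g))) g0.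
rewrite size_map size_iota ltnn => absurd.
suff: false by []; apply: absurd.
  by apply/allP => _ /mapP[t _ ->]; rewrite /root h.
by rewrite map_inj_uniq ?iota_uniq // => a b /eqP; rewrite eqr_nat => /eqP.
Qed.

(* Kronecker's substitution X_i := T^(B^i) reduces this to one variable. *)
Lemma mpoly_int_eq0 n (p : {mpoly int[n]}) :
  (forall c : 'I_n -> algC, ev c p = 0) -> p = 0.
Proof.
(* All exponents in the support of [p] are below [B], hence are base [B] digits. *)
move=> h; pose B := (msize p).+1.
have mB m i : m \in msupp p -> (m i < B)%N.
  move=> /msize_mdeg_lt mlt; apply: leq_ltn_trans (_ : mdeg m < B)%N.
    by rewrite mdegE (bigD1 i) //= leq_addr.
  by apply: ltn_trans mlt _.
pose g : {poly algC} := ev (fun i : 'I_n => 'X^(B ^ i)) p.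
have g0 : g = 0.
  (* The value of [g] at t is that of [p] at the point with coordinates t^(B^i). *)
  apply: poly_eq0_of_nat_roots => t.
  rewrite -[LHS]/(horner_eval _ g) ev_morph; exact: h.
pose k (m : 'X_{1..n}) := (\sum_(i < n) m i * B ^ i)%N.
have gE : g = \sum_(m <- msupp p) (p@_m)%:~R *: 'X^(k m).
  apply: eq_bigr => m _; rewrite -mul_polyC rmorph_int; congr (_ * _).
  rewrite /mmap1 /k -[RHS]prodrXr; apply: eq_bigr => i _.
  by rewrite -exprM mulnC.
have nthP (m : 'X_{1..n}) (i : 'I_n) : nth 0%N m i = m i by rewrite -mnm_nth.
apply/mpolyP => m0; rewrite mcoeff0; apply/eqP/negPn/negP => m0p.
have m0s : m0 \in msupp p by rewrite mcoeff_msupp.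
have := congr1 (fun q : {poly algC} => q`_(k m0)) g0.
rewrite /= coef0 gE coef_sum (bigD1_seq m0) ?msupp_uniq //= coefZ coefXn eqxx mulr1.
rewrite big_seq_cond big1 ?addr0 => [/eqP|m /andP[ms mm0]].
  by rewrite intr_eq0 (negPf m0p).
rewrite coefZ coefXn; case: eqP => [e|_]; last by rewrite mulr0.
case/eqP: mm0; apply/mnmP => i; rewrite -!nthP.
have lt_nth (m' : 'X_{1..n}) (j : nat) : m' \in msupp p -> (nth 0%N m' j < B)%N.
  move=> ms'; case: (ltnP j n) => jn; last by rewrite nth_default ?size_tuple.
  by rewrite (nthP m' (Ordinal jn)) mB.
apply: (@digit_sum_inj B n (nth 0%N m) (nth 0%N m0)) => // [j|j|].
- exact: lt_nth.
- exact: lt_nth.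
- by rewrite /k in e; under eq_bigr do rewrite nthP; under [RHS]eq_bigr do rewrite nthP.
Qed.

End IntegerPolynomials.

(** * Forcing a zero of a system by changing one coefficient *)

Section SystemsWithZero.

Local Open Scope ring_scope.

Lemma heval_morph N d (S T : comRingType) (f : {rmorphism S -> T})
  (H : hmap S N d) (x : vec S N) i :
  f (heval H x i) = heval (fun j m => f (H j m)) (fun j => f (x j)) i.
Proof.
rewrite /heval rmorph_sum; apply: eq_bigr => m _.
rewrite rmorphM rmorph_prod; congr (_ * _).
by apply: eq_bigr => j _; rewrite rmorphXn.
Qed.

Lemma heval_ext N d (S : comRingType) (H H' : hmap S N d) (x x' : vec S N) i :
  (forall j m, H j m = H' j m) -> (forall j, x j = x' j) ->
  heval H x i = heval H' x' i.
Proof.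
move=> eH ex; rewrite /heval; apply: eq_bigr => m _.
by rewrite eH; congr (_ * _); apply: eq_bigr => j _; rewrite ex.
Qed.

Definition pure_power_val N d (i : 'I_N.+1) : {ffun 'I_N.+1 -> 'I_d.+1} :=
  [ffun k => if k == i then ord_max else ord0].

Lemma pure_power_subproof N d (i : 'I_N.+1) :
  (\sum_(k < N.+1) (pure_power_val d i k : nat))%N == d.
Proof.
rewrite (bigD1 i) //= ffunE eqxx /= big1 ?addn0 // => k /negPf ki.
by rewrite ffunE ki.
Qed.

Definition pure_power N d (i : 'I_N.+1) : mon N d :=
  exist _ (pure_power_val d i) (pure_power_subproof d i).

Lemma pure_power_prod N d (S : comRingType) (i : 'I_N.+1) (x : vec S N) :
  \prod_(k < N.+1) x k ^+ (val (pure_power d i) k : nat) = x i ^+ d.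
Proof.
rewrite (bigD1 i) //= ffunE eqxx /= big1 ?mulr1 // => k /negPf ki.
by rewrite ffunE ki.
Qed.

(* The coefficient of x_i^d is changed so that x becomes a zero when x_i = 1. *)
Definition zero_shift N d (S : comRingType) (i : 'I_N.+1)
  (H : hmap S N d) (x : vec S N) : hmap S N d :=
  fun j m => if m == pure_power d i then H j m - heval H x j else H j m.

Lemma heval_zero_shift N d (S : comRingType) (i : 'I_N.+1)
  (H : hmap S N d) (x : vec S N) j : x i = 1 -> heval (zero_shift i H x) x j = 0.
Proof.
move=> xi; rewrite {1}/heval (bigD1 (pure_power d i)) //= /zero_shift eqxx.
rewrite pure_power_prod xi expr1n mulr1 {1}/heval.
rewrite (bigD1 (pure_power d i)) //= pure_power_prod xi expr1n mulr1.
under [X in _ - _ + X = _]eq_bigr => m /negPf mp do rewrite mp.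
by rewrite opprD addrA subrr sub0r addNr.
Qed.

Lemma zero_shift_morph N d (S T : comRingType) (f : {rmorphism S -> T}) i
  (H : hmap S N d) (x : vec S N) j m :
  f (zero_shift i H x j m) =
  zero_shift i (fun j m => f (H j m)) (fun j => f (x j)) j m.
Proof. by rewrite /zero_shift; case: ifP => // _; rewrite rmorphB heval_morph. Qed.

Lemma zero_shift_ext N d (S : comRingType) (H H' : hmap S N d) (x x' : vec S N) i j m :
  (forall j m, H j m = H' j m) -> (forall j, x j = x' j) ->
  zero_shift i H x j m = zero_shift i H' x' j m.
Proof. by move=> eH ex; rewrite /zero_shift eH (heval_ext j eH ex). Qed.

Section Universal.

Variables (N d : nat) (i0 : 'I_N.+1).

Let A := {mpoly int[ncoef N d + N.+1]}.

Let Hu : hmap A N d := fun j m => 'X_(lshift N.+1 (enum_rank (j, m))).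

Let xu : vec A N := fun i => if i == i0 then 1 else 'X_(rshift (ncoef N d) i).

Let val_at (S : comRingType) (H : hmap S N d) (x : vec S N)
  (k : 'I_(ncoef N d + N.+1)) : S :=
  match split k with inl a => coefvec H a | inr i => x i end.

(** The identity is proved once, for the universal system [Hu] and the universal point [xu] with
    coordinate 1 at [i0]. There it concerns one integer polynomial, which is zero because it
    vanishes at all points over [algC]. Every system and point over any ring is a specialization. *)
Lemma resultant_zero_shift (Rz : {mpoly int[ncoef N d]}) :
  (forall (H : hmap algC N d) z, nonzero_vec z -> (forall i, heval H z i = 0) ->
     ev (coefvec H) Rz = 0) ->
  forall (S : comRingType) (H : hmap S N d) (x : vec S N), x i0 = 1 ->
    ev (coefvec (zero_shift i0 H x)) Rz = 0.
Proof.
move=> hR.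
have spec (S : comRingType) (H : hmap S N d) (x : vec S N) : x i0 = 1 ->
    ev (val_at H x) (ev (coefvec (zero_shift i0 Hu xu)) Rz) =
    ev (coefvec (zero_shift i0 H x)) Rz.
  move=> xi; rewrite -[ev (val_at H x)]/(mmap intr (val_at H x)) ev_morph.
  apply: ev_ext => k; rewrite /coefvec zero_shift_morph; apply: zero_shift_ext.
    move=> j m; rewrite /Hu /= mmapX mmap1U /val_at.
    by rewrite -[lshift _ _]/(unsplit (inl _)) unsplitK /coefvec enum_rankK.
  move=> j; rewrite /xu; case: eqP => [->|_]; first by rewrite rmorph1 xi.
  by rewrite /= mmapX mmap1U /val_at -[rshift _ _]/(unsplit (inr _)) unsplitK.
have u0 : ev (coefvec (zero_shift i0 Hu xu)) Rz = 0.
  apply: mpoly_int_eq0 => c.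
  rewrite -[ev c _]/(mmap intr c _) ev_morph.
  pose H : hmap algC N d := fun j m => mmap intr c (Hu j m).
  pose x : vec algC N := fun j => mmap intr c (xu j).
  have xi : x i0 = 1 by rewrite /x /xu eqxx rmorph1.
  rewrite -[RHS](hR (zero_shift i0 H x) x).
  - by apply: ev_ext => k; rewrite /coefvec zero_shift_morph.
  - by exists i0; rewrite xi oner_neq0.
  - by move=> i; apply: heval_zero_shift.
by move=> S H x xi; rewrite -spec // u0 /ev mmap0.
Qed.

End Universal.

End SystemsWithZero.

(** * Transfer of vanishing from [algC] to arbitrary fields *)

Section VanishingTransfer.

Local Open Scope ring_scope.

Section Homogenization.

Variables (n : nat) (s : 'I_n -> int).

(* T^D p(s + w/T) as a polynomial in T *)
Definition line_poly (S : comRingType) (w : 'I_n -> S) (D : nat) (p : {mpoly int[n]})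
  : {poly S} :=
  \sum_(m <- msupp p) (p@_m)%:~R *:
    ('X^(D - mdeg m) * \prod_(i < n) ((s i)%:~R *: 'X + (w i)%:P) ^+ m i).

Lemma map_line_poly (S T : comRingType) (f : {rmorphism S -> T}) w D p :
  map_poly f (line_poly w D p) = line_poly (fun i => f (w i)) D p.
Proof.
rewrite rmorph_sum; apply: eq_bigr => m _ /=.
rewrite map_polyZ rmorph_int rmorphM /= map_polyXn rmorph_prod; congr (_ *: (_ * _)).
by apply: eq_bigr => i _; rewrite rmorphXn rmorphD /= map_polyZ rmorph_int map_polyX map_polyC.
Qed.

Lemma horner_line_poly (F : fieldType) (w : 'I_n -> F) D p (t : F) :
  (msize p <= D)%N -> t != 0 ->
  (line_poly w D p).[t] = t ^+ D * ev (fun i => (s i)%:~R + w i / t) p.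
Proof.
move=> pD t0; rewrite /line_poly horner_sum /ev /mmap mulr_sumr.
rewrite !big_seq; apply: eq_bigr => m ms.
(* This makes the truncated subtraction [D - mdeg m] exact. *)
have mD : (mdeg m <= D)%N by apply: leq_trans pD; apply/ltnW/msize_mdeg_lt.
rewrite hornerZ hornerM hornerXn [RHS]mulrCA; congr (_ * _).
rewrite -[in RHS](subnK mD) exprD -mulrA; congr (_ * _).
rewrite mdegE -prodrXr /mmap1 -big_split horner_prod; apply: eq_bigr => i _ /=.
rewrite horner_exp hornerD hornerZ hornerX hornerC -exprMn; congr (_ ^+ _).
by rewrite mulrDr mulrC mulrCA divff // mulr1.
Qed.

(** Over a general commutative ring leading coefficients can multiply to zero, so the coefficient at
    a prescribed degree bound is followed instead. *)
Lemma top_coef_mul (S : comRingType) (p q : {poly S}) a b :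
  (size p <= a.+1)%N -> (size q <= b.+1)%N ->
  (size (p * q)%R <= (a + b).+1)%N /\ (p * q)`_(a + b) = p`_a * q`_b.
Proof.
move=> pa qb; split.
  by apply: leq_trans (size_polyMleq _ _) _; rewrite -subn1 leq_subLR add1n -addSn -addnS leq_add.
rewrite coefM (bigD1 (inord a)) //= inordK ?ltnS ?leq_addr // addKn.
rewrite big1 ?addr0 // => j ja.
case: (ltngtP j a) => [lt|gt|e].
- rewrite [X in _ * X]nth_default ?mulr0 //; apply: leq_trans qb _.
  by rewrite ltn_subRL ltn_add2r.
- by rewrite nth_default ?mul0r //; apply: leq_trans pa _.
- by case/eqP: ja; apply: val_inj; rewrite /= inordK // ltnS leq_addr.
Qed.

Lemma top_coef_exp (S : comRingType) (p : {poly S}) k :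
  (size p <= 2)%N -> (size (p ^+ k) <= k.+1)%N /\ (p ^+ k)`_k = p`_1 ^+ k.
Proof.
move=> p2; elim: k => [|k [IH1 IH2]]; first by rewrite !expr0 size_poly1 coef1.
by rewrite !exprS -IH2; apply: (@top_coef_mul S p (p ^+ k) 1 k).
Qed.

Lemma top_coef_prod (S : comRingType) (I : Type) (r : seq I) (P : I -> {poly S})
  (a : I -> nat) : (forall i, size (P i) <= (a i).+1)%N ->
  (size (\prod_(i <- r) P i)%R <= (\sum_(i <- r) a i).+1)%N /\
  (\prod_(i <- r) P i)`_(\sum_(i <- r) a i) = \prod_(i <- r) (P i)`_(a i).
Proof.
move=> h; elim: r => [|i r [IH1 IH2]]; first by rewrite !big_nil size_poly1 coef1.
by rewrite !big_cons -IH2; apply: top_coef_mul.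
Qed.

(** In each linear factor s_i T + w_i the top coefficient is s_i, so the terms add up to p(s) in
    degree [D]. When p(s) = 1 the polynomial is monic whatever w is. *)
Lemma top_coef_line_poly (S : comRingType) (w : 'I_n -> S) D p :
  (msize p <= D)%N ->
  (size (line_poly w D p) <= D.+1)%N /\
  (line_poly w D p)`_D = ev (fun i => (s i)%:~R) p.
Proof.
move=> pD.
have lin i : (size ((s i)%:~R *: 'X + (w i)%:P)%R <= 2)%N.
  apply: leq_trans (size_polyD _ _) _; rewrite geq_max.
  rewrite (leq_trans (size_scale_leq _ _)) ?size_polyX //.
  by rewrite (leq_trans (size_polyC_leq1 _)).
have term m : m \in msupp p ->
    let t := 'X^(D - mdeg m) * \prod_(i < n) ((s i)%:~R *: 'X + (w i)%:P) ^+ m i in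
    (size t <= D.+1)%N /\ t`_D = mmap1 (fun i => (s i)%:~R) m.
  move=> ms /=; have mD : (mdeg m <= D)%N.
    by apply: leq_trans pD; apply/ltnW/msize_mdeg_lt.
  have [sz tp] := @top_coef_prod S _ (index_enum 'I_n)
    (fun i => ((s i)%:~R *: 'X + (w i)%:P) ^+ m i) m
    (fun i => proj1 (top_coef_exp (m i) (lin i))).
  rewrite -mdegE in sz tp.
  have := @top_coef_mul S 'X^(D - mdeg m) _ (D - mdeg m) (mdeg m) _ sz.
  rewrite subnK // size_polyXn leqnn => /(_ isT) [-> ->]; split=> //.
  rewrite coefXn eqxx mul1r tp; apply: eq_bigr => i _.
  rewrite (proj2 (top_coef_exp (m i) (lin i))); congr (_ ^+ _).
  by rewrite coefD coefZ coefX coefC mulr1 addr0.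
split.
  rewrite /line_poly big_seq; apply: (leq_trans (size_sum _ _ _)).
  apply/bigmax_leqP_seq => m ms _.
  by apply: leq_trans (size_scale_leq _ _) _; case: (term m ms).
rewrite /line_poly coef_sum /ev /mmap !big_seq; apply: eq_bigr => m ms.
by rewrite coefZ; congr (_ * _); case: (term m ms).
Qed.

End Homogenization.

(** Multiplicities are harmless: each linear factor is charged to its own copy of [q]. *)
Lemma prod_XsubC_dvdp_exp (F : fieldType) (rs : seq F) (q : {poly F}) :
  (forall z, z \in rs -> root q z) -> \prod_(z <- rs) ('X - z%:P) %| q ^+ size rs.
Proof.
elim: rs => [|z rs IH] h; first by rewrite big_nil expr0 dvd1p.
rewrite big_cons exprS; apply: dvdp_mul.
  by rewrite dvdp_XsubCl h ?mem_head.
by apply: IH => y yrs; apply: h; rewrite inE yrs orbT.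
Qed.

(* Over Z[w], the monic polynomial T^D p(s + w/T) divides a power of
   T * T^E q(s + w/T), because it does so for all complex w; at T = 1 this
   specializes to any field. *)
Lemma vanishing_transfer n (p q : {mpoly int[n]}) (s : 'I_n -> int) :
  p.@[s] = 1 -> (forall c : 'I_n -> algC, ev c p = 0 -> ev c q = 0) ->
  forall (F : fieldType) (c : 'I_n -> F), ev c p = 0 -> ev c q = 0.
Proof.
move=> ps pq F c pc.
have ps1 (S : comRingType) : ev (fun i => (s i)%:~R) p = 1 :> S.
  have <- := ev_morph (intmul (1 : S)) s p.
  suff -> : ev s p = p.@[s] by rewrite ps.
  by rewrite /ev /mmap mevalE; apply: eq_bigr => m _; rewrite intz.
pose D := msize p; pose E := msize q; pose A := {mpoly int[n]}.
pose P (S : comRingType) (w : 'I_n -> S) := line_poly s w D p.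
pose Q (S : comRingType) (w : 'I_n -> S) := line_poly s w E q.
have [szP Pmonic] : (forall (S : comRingType) (w : 'I_n -> S), size (P S w) = D.+1) /\
    (forall (S : comRingType) (w : 'I_n -> S), P S w \is monic).
  suff h (S : comRingType) (w : 'I_n -> S) : size (P S w) = D.+1 /\ (P S w)`_D = 1.
    by split=> S w; have [sz tp] := h S w; rewrite ?monicE ?lead_coefE ?sz /= ?tp.
  have [sz tp] := top_coef_line_poly s w (leqnn D); rewrite ps1 in tp; split=> //.
  apply/eqP; rewrite eqn_leq sz ltnNge; apply/negP => szD.
  by have /eqP := tp; rewrite nth_default // eq_sym oner_eq0.
pose wu : 'I_n -> A := fun i => 'X_i.
have ev_wu (S : comRingType) (w : 'I_n -> S) i : mmap intr w (wu i) = w i.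
  by rewrite mmapX mmap1U.
have map_P (S : comRingType) (w : 'I_n -> S) : map_poly (mmap intr w) (P A wu) = P S w.
  rewrite map_line_poly; apply: eq_bigr => m _; congr (_ *: (_ * _)).
  by apply: eq_bigr => i _; congr ((_ + _%:P) ^+ _); apply: ev_wu.
have map_Q (S : comRingType) (w : 'I_n -> S) : map_poly (mmap intr w) (Q A wu) = Q S w.
  rewrite map_line_poly; apply: eq_bigr => m _; congr (_ *: (_ * _)).
  by apply: eq_bigr => i _; congr ((_ + _%:P) ^+ _); apply: ev_wu.
(* Division by a monic polynomial is possible over Z[w]. At every w over [algC] the divisor keeps
   its size and divides the remainder, which is smaller and hence zero; so all coefficients of the
   remainder vanish identically. *)
have div := Pdiv.RingMonic.rdivp_eq (Pmonic A wu) (('X * Q A wu) ^+ D).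
set r := Pdiv.Ring.rmodp _ _ in div.
have szr : (size r < size (P A wu))%N.
  exact/Pdiv.Ring.ltn_rmodpN0/monic_neq0/Pmonic.
have r0 : r = 0.
  apply/polyP => k; rewrite coef0; apply: mpoly_int_eq0 => w.
  have -> : ev w r`_k = (map_poly (mmap intr w) r)`_k by rewrite coef_map.
  suff -> : map_poly (mmap intr w) r = 0 by rewrite coef0.
  have := congr1 (map_poly (mmap intr w)) div.
  rewrite rmorphXn rmorphM rmorphD rmorphM /= map_P map_Q map_polyX => divw.
  have Pdvd : P algC w %| ('X * Q algC w) ^+ D.
    have [rs Prs] := closed_field_poly_normal (P algC w).
    rewrite (monicP (Pmonic _ w)) scale1r in Prs.
    have <- : size rs = D.
      by apply: succn_inj; rewrite -(szP algC w) Prs size_prod_XsubC.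
    rewrite [X in X %| _]Prs; apply: prod_XsubC_dvdp_exp => z zrs.
    have rz : root (P algC w) z by rewrite Prs root_prod_XsubC.
    (* At a nonzero root z, p(s + w/z) = 0 and the hypothesis on [p] and [q] applies. The extra
       factor ['X] takes care of the root 0. *)
    rewrite rootM rootX; case: eqP => //= /eqP z0.
    move: rz; rewrite /root !horner_line_poly // mulf_eq0 expf_eq0 (negPf z0) andbF /=.
    by move=> /eqP /pq ->; rewrite mulr0.
  have Pr : P algC w %| map_poly (mmap intr w) r.
    move: Pdvd; rewrite divw dvdp_addr // dvdp_mull //.
  apply/eqP/negPn/negP => /dvdp_leq /(_ Pr); rewrite leqNgt => /negP; apply.
  by apply: leq_ltn_trans (size_poly _ _) _; rewrite szP -(szP A wu).
rewrite r0 addr0 in div.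
(* With this w the point s + w/T is [c] at T = 1. *)
pose w i := c i - (s i)%:~R.
have := congr1 (fun g => (map_poly (mmap intr w) g).[1]) div.
rewrite /= rmorphXn !rmorphM /= map_P map_Q map_polyX horner_exp !hornerM hornerX.
have evw g : ev (fun i => (s i)%:~R + w i / 1) g = ev c g.
  by apply: ev_ext => i; rewrite /w divr1 addrC subrK.
rewrite !horner_line_poly ?oner_neq0 // !evw pc mulr0 mulr0 expr1n !mul1r => /eqP.
by rewrite expf_eq0 => /andP[_ /eqP].
Qed.

End VanishingTransfer.

(** * Ultrametric absolute values and uncountability of complete fields *)

Section UltrametricAbsoluteValue.

Variables (K : fieldType) (abs : K -> R) (Habs : nonarch_abs abs).

Lemma abs_ge0 x : 0 <= abs x.
Proof. by case: Habs => + _; apply. Qed.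

Lemma abs_eq0 x : abs x = 0 <-> x = 0%R.
Proof. by case: Habs => _ [+ _]; apply. Qed.

Lemma absM x y : abs (x * y)%R = abs x * abs y.
Proof. by case: Habs => _ [_ [+ _]]; apply. Qed.

Lemma abs_add x y : abs (x + y)%R <= Rmax (abs x) (abs y).
Proof. by case: Habs => _ [_ [_ +]]; apply. Qed.

Lemma abs0 : abs 0%R = 0.
Proof. exact/abs_eq0. Qed.

Lemma abs_gt0 x : x <> 0%R -> 0 < abs x.
Proof.
move=> x0; case: (Rle_lt_or_eq_dec _ _ (abs_ge0 x)) => // e.
by case: x0; apply/abs_eq0.
Qed.

Lemma abs1 : abs 1%R = 1.
Proof.
have h := absM 1%R 1%R; rewrite mulr1 in h.
have p : 0 < abs 1%R by apply: abs_gt0; apply/eqP; rewrite oner_eq0.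
nra.
Qed.

Lemma absN1 : abs (-1)%R = 1.
Proof.
have h := absM (-1)%R (-1)%R; rewrite mulrNN mulr1 abs1 in h.
by have p := abs_ge0 (-1)%R; nra.
Qed.

Lemma absN x : abs (- x)%R = abs x.
Proof. by rewrite -mulN1r absM absN1; lra. Qed.

Lemma abs_subC x y : abs (x - y)%R = abs (y - x)%R.
Proof. by rewrite -absN opprB. Qed.

Lemma absX x n : abs (x ^+ n)%R = abs x ^ n.
Proof. by elim: n => [|n IH]; rewrite ?expr0 ?abs1 //= exprS absM IH. Qed.

Lemma absV x : x <> 0%R -> abs (x^-1)%R = / abs x.
Proof.
move=> x0; have p := abs_gt0 x0.
have h := absM x (x^-1)%R; rewrite divff ?abs1 in h; last exact/eqP.
by apply: (Rmult_eq_reg_l (abs x)); [rewrite -h; field; lra | lra].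
Qed.

Lemma abs_add_le x y b : abs x <= b -> abs y <= b -> abs (x + y)%R <= b.
Proof. by move=> hx hy; apply: Rle_trans (abs_add x y) _; apply: Rmax_lub. Qed.

Lemma abs_sub_le x y b : abs x <= b -> abs y <= b -> abs (x - y)%R <= b.
Proof. by move=> hx hy; apply: abs_add_le; rewrite ?absN. Qed.

Lemma abs_int_le1 (z : int) : abs (z%:~R)%R <= 1.
Proof.
have nat1 (k : nat) : abs (k%:R)%R <= 1.
  elim: k => [|k IH]; first by rewrite abs0; lra.
  by rewrite -addn1 natrD; apply: abs_add_le => //; rewrite abs1; lra.
by case: z => k; rewrite ?NegzE ?mulrNz ?absN; apply: nat1.
Qed.

(** Ultrametric triangles are isosceles. *)
Lemma abs_eq_of_sub_lt x y : abs (x - y)%R < abs x -> abs y = abs x.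
Proof.
move=> h; apply: Rle_antisym.
  have -> : y = (x - (x - y))%R by rewrite subKr.
  by apply: abs_sub_le; lra.
case: (Rle_lt_dec (abs x) (abs y)) => // lt.
have : abs x <= Rmax (abs (x - y)%R) (abs y) by rewrite -{1}(subrK y x); apply: abs_add.
by have := Rmax_lub_lt _ _ _ h lt; lra.
Qed.

(* closed under sums and products, so integer polynomials are 1-Lipschitz on the unit ball *)
Definition unit_close e (x y : K) := abs x <= 1 /\ abs y <= 1 /\ abs (x - y)%R <= e.

Lemma unit_close_add e x y x' y' :
  unit_close e x y -> unit_close e x' y' -> unit_close e (x + x')%R (y + y')%R.
Proof.
move=> [h1 [h2 h3]] [h1' [h2' h3']]; split; first exact: abs_add_le.
by split; [exact: abs_add_le | rewrite opprD addrACA; apply: abs_add_le].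
Qed.

Lemma unit_close_mul e x y x' y' :
  unit_close e x y -> unit_close e x' y' -> unit_close e (x * x')%R (y * y')%R.
Proof.
have p := abs_ge0.
move=> [h1 [h2 h3]] [h1' [h2' h3']]; rewrite /unit_close !absM.
split; first by have := (p x, p x'); move=> [? ?]; nra.
split; first by have := (p y, p y'); move=> [? ?]; nra.
have -> : (x * x' - y * y' = x * (x' - y') + (x - y) * y')%R.
  by rewrite mulrBr mulrBl addrA subrK.
apply: abs_add_le; rewrite absM.
- by move: (p x) (p (x' - y')%R) => ? ?; nra.
- by move: (p y') (p (x - y)%R) => ? ?; nra.
Qed.

Lemma unit_close_refl e x : 0 <= e -> abs x <= 1 -> unit_close e x x.
Proof. by move=> e0 x1; split=> //; split=> //; rewrite subrr abs0. Qed.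

Lemma unit_close_exp e x y n : 0 <= e -> unit_close e x y -> unit_close e (x ^+ n)%R (y ^+ n)%R.
Proof.
move=> e0 h; elim: n => [|n IH]; last by rewrite !exprS; apply: unit_close_mul.
by rewrite !expr0; apply: unit_close_refl; rewrite // abs1; lra.
Qed.

Lemma unit_close_sum e (I : Type) (r : seq I) (P : pred I) (F G : I -> K) : 0 <= e ->
  (forall i, P i -> unit_close e (F i) (G i)) ->
  unit_close e (\sum_(i <- r | P i) F i)%R (\sum_(i <- r | P i) G i)%R.
Proof.
move=> e0 h; elim/big_rec2: _ => [|i x y Pi]; last exact/unit_close_add/h.
by apply: unit_close_refl; rewrite // abs0; lra.
Qed.

Lemma unit_close_prod e (I : Type) (r : seq I) (P : pred I) (F G : I -> K) : 0 <= e ->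
  (forall i, P i -> unit_close e (F i) (G i)) ->
  unit_close e (\prod_(i <- r | P i) F i)%R (\prod_(i <- r | P i) G i)%R.
Proof.
move=> e0 h; elim/big_rec2: _ => [|i x y Pi]; last exact/unit_close_mul/h.
by apply: unit_close_refl; rewrite // abs1; lra.
Qed.

Lemma unit_close_ev e n (p : {mpoly int[n]}) (c c' : 'I_n -> K) : 0 <= e ->
  (forall i, unit_close e (c i) (c' i)) -> unit_close e (ev c p) (ev c' p).
Proof.
move=> e0 h; apply: unit_close_sum => // m _; apply: unit_close_mul.
  by apply: unit_close_refl => //; apply: abs_int_le1.
by apply: unit_close_prod => // i _; apply: unit_close_exp.
Qed.

Lemma exists_small : nontrivial_abs abs -> exists c, 0 < abs c < 1.
Proof.
move=> [x [x0 x1]].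
have xn0 : x <> 0%R by move=> e; apply: x0; apply/abs_eq0.
have p := abs_gt0 xn0.
case: (Rtotal_order (abs x) 1) => [lt|[//|gt]]; first by exists x.
exists (x^-1)%R; rewrite absV //; split; first exact: Rinv_0_lt_compat.
by rewrite -Rinv_1; apply: Rinv_lt_contravar; lra.
Qed.

(** For 0 < |c| < 1 the points a + c^(k0 + k) are pairwise distinct, since their distances to [a]
    strictly decrease, and all lie within [r] of [a] when [k0] is large. By counting, one of the
    first [size E + 1] of them is outside [E]. *)
Lemma exists_near_not_in : nontrivial_abs abs ->
  forall (a : K) r (E : seq K), 0 < r -> exists b, abs (b - a)%R < r /\ b \notin E.
Proof.
move=> /exists_small [c [c0 c1]] a r E r0.
have [k0 hk0] : exists k0, forall k, (k0 <= k)%coq_nat -> abs c ^ k < r.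
  have [k0 hk0] := pow_lt_1_zero (abs c) ltac:(rewrite Rabs_pos_eq; lra) r r0.
  exists k0 => k /hk0; apply: Rle_lt_trans; exact: Rle_abs.
pose f k : K := (a + c ^+ (k0 + k))%R.
have cn0 : c <> 0%R by move=> e; move: c0; rewrite e abs0; lra.
have f_inj : injective f.
  have lt_pow i j : (i < j)%N -> abs (c ^+ (k0 + j))%R < abs (c ^+ (k0 + i))%R.
    move=> ij; have -> : (k0 + j = (k0 + i) + (j - i))%N by rewrite -addnA subnKC // ltnW.
    rewrite exprD absM !absX; have p : 0 < abs c ^ (k0 + i) by apply: pow_lt.
    have [_ lt1] : 0 <= abs c ^ (j - i) < 1.
      have ji : (0 < j - i)%coq_nat by apply/ltP; rewrite subn_gt0.
      by apply: (pow_lt_1_compat _ _ _ ji); lra.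
    by rewrite -[X in _ < X]Rmult_1_r; apply: Rmult_lt_compat_l.
  move=> i j /addrI e; case: (ltngtP i j) => // /lt_pow; rewrite e; lra.
case: (classic (forall k, (k < (size E).+1)%N -> f k \in E)) => h.
  have := @uniq_leq_size _ (map f (iota 0 (size E).+1)) E.
  rewrite map_inj_uniq ?iota_uniq // size_map size_iota ltnn => absurd.
  suff: false by []; apply: absurd => // x /mapP[k]; rewrite mem_iota => /= kE ->.
  exact: h.
have [k hk] := not_all_ex_not _ _ h.
exists (f k); split; last by apply/negP => fE; apply: hk.
by rewrite /f addrAC subrr add0r absX; apply: hk0; apply/leP/leq_addr.
Qed.

Lemma exists_separation (b : K) (E : seq K) : b \notin E ->
  exists2 r, 0 < r & forall e, e \in E -> r <= abs (b - e)%R.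
Proof.
elim: E => [|e E IH]; first by exists 1; [lra|].
rewrite inE negb_or => /andP[be /IH [r r0 hr]].
have p : 0 < abs (b - e)%R by apply: abs_gt0 => /eqP; rewrite subr_eq0; apply/negP.
exists (Rmin r (abs (b - e)%R)); first exact: Rmin_glb_lt.
move=> x; rewrite inE => /orP[/eqP ->|/hr h]; first exact: Rmin_r.
by apply: Rle_trans (Rmin_l _ _) h.
Qed.

(** A Baire argument: nested balls are chosen so that ball k + 1 avoids the finite set [E k], and
    completeness gives a point in all of them. *)
Lemma not_countable : nontrivial_abs abs -> complete_abs abs ->
  forall E : nat -> seq K, exists a, forall s, a \notin E s.
Proof.
move=> Hnt Hcomp E.
(* Positivity of the radius is a premise inside the existential, so that choice yields a total
   function [next]. Halving the radius makes the centres Cauchy. *)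
have step (n : nat) (ar : K * R) : exists br : K * R, 0 < ar.2 ->
    abs (br.1 - ar.1)%R < ar.2 /\ 0 < br.2 <= ar.2 / 2 /\
    forall e, e \in E n -> br.2 <= abs (br.1 - e)%R.
  case: (Rlt_dec 0 ar.2) => [r0|]; last by exists ar.
  have [b [hb /exists_separation [r' r'0 hr']]] := exists_near_not_in Hnt ar.1 (E n) r0.
  exists (b, Rmin r' (ar.2 / 2)) => _ /=; split=> //; split.
    by split; [apply: Rmin_glb_lt; lra | apply: Rmin_r].
  by move=> e /hr'; apply: Rle_trans; apply: Rmin_l.
pose next n ar := proj1_sig (constructive_indefinite_description _ (step n ar)).
have nextP n ar := proj2_sig (constructive_indefinite_description _ (step n ar)).
pose fix s n : K * R := if n is k.+1 then next k (s k) else (0%R, 1).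
have s_pos n : 0 < (s n).2.
  by elim: n => [|n IH] /=; [lra | case: (nextP n (s n) IH) => _ [[]]].
have s_step n := nextP n (s n) (s_pos n).
have s_small n : (s n).2 <= (1 / 2) ^ n.
  elim: n => [|n IH]; first by rewrite /=; lra.
  have [_ [[_ h] _]] := s_step n.
  change ((s n.+1).2 <= (s n).2 / 2) in h.
  by change ((s n.+1).2 <= (1 / 2) * (1 / 2) ^ n); lra.
have s_near n k : abs ((s (n + k)%N).1 - (s n).1)%R < (s n).2 /\ (s (n + k)%N).2 <= (s n).2.
  elim: k => [|k [IH1 IH2]]; first by rewrite addn0 subrr abs0; split; [apply: s_pos | lra].
  rewrite addnS; have [h1 [[_ h2] _]] := s_step (n + k)%N.
  have p := s_pos (n + k)%N.
  change (abs ((s (n + k).+1).1 - (s (n + k)%N).1)%R < (s (n + k)%N).2) in h1.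
  change ((s (n + k).+1).2 <= (s (n + k)%N).2 / 2) in h2.
  split; last by lra.
  have -> : ((s (n + k).+1).1 - (s n).1 =
    ((s (n + k).+1).1 - (s (n + k)%N).1) + ((s (n + k)%N).1 - (s n).1))%R.
    by rewrite addrA subrK.
  by apply: Rle_lt_trans (abs_add _ _) _; apply: Rmax_lub_lt => //; lra.
have [|l hl] := Hcomp (fun n => (s n).1).
  move=> e e0; have [M hM] := pow_lt_1_zero (1 / 2) ltac:(rewrite Rabs_pos_eq; lra) e e0.
  have hM' : (s M).2 < e.
    by apply: Rle_lt_trans (s_small M) _; apply: Rle_lt_trans (Rle_abs _) (hM M _); apply/leP.
  exists M => m n /leP Mm /leP Mn.
  have -> : ((s m).1 - (s n).1 = ((s m).1 - (s M).1) + ((s M).1 - (s n).1))%R.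
    by rewrite addrA subrK.
  apply: Rle_lt_trans (abs_add _ _) _.
  have [a1 _] := s_near M (m - M)%N; have [a2 _] := s_near M (n - M)%N.
  rewrite subnKC // in a1; rewrite subnKC // in a2.
  by apply: Rmax_lub_lt; [|rewrite abs_subC]; [apply: Rlt_trans a1 hM' | apply: Rlt_trans a2 hM'].
exists l => k; apply/negP => lE.
(* Open ultrametric balls are closed: the limit stays at distance less than the radius from the
   centre, whereas a point of [E k] is at least the radius away. *)
have [_ [_ sep]] := s_step k; have := sep l lE.
change ((s k.+1).2 <= abs ((s k.+1).1 - l)%R -> False) => /Rle_not_lt; apply.
have [M hM] := hl _ (s_pos k.+1).
have h1 := hM (k.+1 + M)%N ltac:(apply/leP; exact: leq_addl).
have [h2 _] := s_near k.+1 M.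
have -> : ((s k.+1).1 - l =
  ((s k.+1).1 - (s (k.+1 + M)%N).1) + ((s (k.+1 + M)%N).1 - l))%R.
  by rewrite addrA subrK.
by apply: Rle_lt_trans (abs_add _ _) _; apply: Rmax_lub_lt => //; rewrite abs_subC.
Qed.

End UltrametricAbsoluteValue.

(** * Ideals over an uncountable algebraically closed field *)

Section Nullstellensatz.

From mathcomp Require Import ring.

Local Open Scope ring_scope.

Definition is_ideal (A : comRingType) (J : A -> Prop) :=
  J 0 /\ (forall f g, J f -> J g -> J (f + g)) /\ (forall h f, J f -> J (h * f)).

Lemma ideal_sum (A : comRingType) (J : A -> Prop) (I : Type) (r : seq I) (P : pred I) (F : I -> A) :
  is_ideal J -> (forall i, P i -> J (F i)) -> J (\sum_(i <- r | P i) F i).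
Proof.
by move=> [J0 [JD JM]] h; elim/big_rec: _ => // i f Pi; apply: JD; apply: h.
Qed.

Lemma ideal_sub (A : comRingType) (J : A -> Prop) f g :
  is_ideal J -> J f -> J g -> J (f - g).
Proof. by move=> [_ [JD JM]] hf hg; apply: JD => //; rewrite -mulN1r; apply: JM. Qed.

(* Both sides are y^e p(w/y) up to a power of y, where
   p = \sum_j c_j \prod_(k != j) (T - a_k) splits over F. *)
Lemma split_binary_form (F : closedFieldType) n (y w : {mpoly F[n]}) M (a c : 'I_M -> F) j :
  y != 0 -> injective a -> c j != 0 ->
  exists rs : seq F, exists2 l : F, l != 0 &
    y ^+ size rs * (\sum_j (c j)%:MP * \prod_(k | k != j) (w - (a k)%:MP * y)) =
    l%:MP * y ^+ M.-1 * \prod_(b <- rs) (w - b%:MP * y).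
Proof.
move=> y0 a_inj cj.
pose p : {poly F} := \sum_j c j *: \prod_(k | k != j) ('X - (a k)%:P).
have p0 : p != 0.
  apply/eqP => /(congr1 (fun q => q.[a j])); rewrite horner0 horner_sum (bigD1 j) //=.
  rewrite [X in _ + X]big1 ?addr0 => [/eqP|i ij].
    rewrite hornerZ horner_prod mulf_eq0 (negPf cj) /= prodf_seq_eq0.
    case/hasP => k _ /andP[kj]; rewrite hornerXsubC subr_eq0 => /eqP /a_inj e.
    by rewrite e eqxx in kj.
  by rewrite hornerZ horner_prod (bigD1 j) 1?eq_sym //= hornerXsubC subrr mul0r mulr0.
have [rs prs] := closed_field_poly_normal p.
exists rs; exists (lead_coef p); first by rewrite lead_coef_eq0.
pose io : {rmorphism {mpoly F[n]} -> {fraction {mpoly F[n]}}} := @FracField.tofrac _.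
pose ka : {rmorphism F -> {fraction {mpoly F[n]}}} := io \o @mpolyC n F.
have Y0 : io y != 0 by rewrite tofrac_eq0.
pose th := io w / io y.
have lin b : io (w - b%:MP * y) = io y * (th - ka b).
  by rewrite rmorphB rmorphM mulrBr mulrC /th mulrCA divff // mulr1 [io y * _]mulrC.
have lins (I : Type) (r : seq I) (f : I -> F) :
    io (\prod_(i <- r) (w - (f i)%:MP * y)) = io y ^+ size r * \prod_(i <- r) (th - ka (f i)).
  elim: r => [|i r IH]; first by rewrite !big_nil rmorph1 mulr1.
  by rewrite !big_cons rmorphM IH lin exprS !mulrA; congr (_ * _); rewrite mulrAC.
have hp : (map_poly ka p).[th] = \sum_j ka (c j) * \prod_(k | k != j) (th - ka (a k)).
  rewrite rmorph_sum horner_sum; apply: eq_bigr => i _ /=.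
  rewrite map_polyZ hornerZ rmorph_prod horner_prod; congr (_ * _).
  by apply: eq_bigr => k _; rewrite /= map_polyXsubC hornerXsubC.
have hp2 : (map_poly ka p).[th] = ka (lead_coef p) * \prod_(b <- rs) (th - ka b).
  rewrite [in LHS]prs map_polyZ hornerZ rmorph_prod horner_prod; congr (_ * _).
  by apply: eq_bigr => k _; rewrite /= map_polyXsubC hornerXsubC.
apply/eqP; rewrite -tofrac_eq; apply/eqP.
rewrite -/io !rmorphM !rmorphXn /= lins.
transitivity (io y ^+ size rs * (io y ^+ M.-1 * (map_poly ka p).[th])).
  congr (_ * _); rewrite hp mulr_sumr rmorph_sum; apply: eq_bigr => i _.
  rewrite rmorphM mulrCA; congr (_ * _).
  transitivity (io (\prod_(k <- [seq k <- index_enum 'I_M | k != i]) (w - (a k)%:MP * y))).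
    by rewrite big_filter.
  rewrite lins big_filter; congr (_ ^+ _ * _).
  by rewrite -sum1_size big_filter sum1_card cardC1 card_ord.
rewrite hp2; change (io (lead_coef p)%:MP) with (ka (lead_coef p)).
ring.
Qed.

Section Step.

Variables (F : closedFieldType) (n : nat).
Hypothesis uncountable : forall E : nat -> seq F, exists a, forall s, a \notin E s.

Local Notation A := {mpoly F[n]}.

(** The coefficient matrix of the [g j] has more rows than columns, so its left kernel is
    nonzero. *)
Lemma linear_dependence M s (g : 'I_M -> A) :
  (forall j, (msize (g j) <= s)%N) -> (#|{: 'X_{1..n < s}}| < M)%N ->
  exists c : 'I_M -> F, (exists j, c j != 0) /\ \sum_j (c j)%:MP * g j = 0.
Proof.
move=> gs ltM.
pose G : 'M[F]_(M, #|{: 'X_{1..n < s}}|) := \matrix_(j, k) (g j)@_(enum_val k : 'X_{1..n < s}).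
have /rowV0Pn [v /sub_kermxP vG v0] : kermx G != 0.
  rewrite kermx_eq0 /row_free; apply/eqP => e.
  by have := rank_leq_col G; rewrite e leqNgt ltM.
exists (fun j => v 0 j); split.
  case/rV0Pn: v0 => j vj; by exists j.
apply/mpolyP => m; rewrite mcoeff0 raddf_sum /=.
under eq_bigr do rewrite mcoeffCM.
case: (ltnP (mdeg m) s) => ms; last first.
  apply: big1 => j _; rewrite memN_msupp_eq0 ?mulr0 //.
  by apply: contraTN (leq_trans (gs j) ms) => /msize_mdeg_lt; rewrite -ltnNge.
have := congr1 (fun B : 'rV_ _ => B 0 (enum_rank (BMultinom ms))) vG.
by rewrite !mxE /= => e; rewrite -[RHS]e; apply: eq_bigr => j _; rewrite !mxE enum_rankK.
Qed.

(** Otherwise each [P k] would hold only on a finite set, and these countably many finite sets would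
    cover [F]. The index pairs are enumerated by [pickle]. *)
Lemma uncountable_fiber (P : nat * nat -> F -> Prop) : (forall a, exists k, P k a) ->
  exists k, forall E : seq F, exists2 a, P k a & a \notin E.
Proof.
move=> h; apply: NNPP => no.
have fin k : exists E : seq F, forall a, P k a -> a \in E.
  apply: NNPP => nE; apply: no; exists k => E; apply: NNPP => nE2; apply: nE.
  by exists E => a Pa; apply/negPn/negP => aE; apply: nE2; exists a.
pose E k := proj1_sig (constructive_indefinite_description _ (fin k)).
have EP k := proj2_sig (constructive_indefinite_description _ (fin k)).
have [a ha] := uncountable (fun s => if @unpickle (nat * nat)%type s is Some k then E k else [::]).
have [k Pka] := h a; have := ha (pickle k).
by rewrite pickleK => /negP; apply; apply: EP.
Qed.

Lemma distinct_choices (B : Type) (P : F -> B -> Prop) :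
  (forall E : seq F, exists2 a, (exists b, P a b) & a \notin E) ->
  forall M, exists (a : 'I_M -> F) (b : 'I_M -> B), injective a /\ forall j, P (a j) (b j).
Proof.
move=> h M.
have [l [lu lM lP]] : exists l : seq (F * B), [/\ uniq (map fst l), size l = M &
    forall i x0, (i < M)%N -> P (nth x0 l i).1 (nth x0 l i).2].
  elim: M => [|M [l [lu lM lP]]]; first by exists [::].
  have [a [b Pab] al] := h (map fst l).
  exists ((a, b) :: l); split=> /=; rewrite ?al ?lu ?lM //.
  by move=> [|i] x0 //= iM; apply: lP.
have [a0 [b0 _] _] := h [::].
exists (fun j => (nth (a0, b0) l j).1), (fun j => (nth (a0, b0) l j).2); split.
  move=> i j /eqP; rewrite -!(nth_map _ a0 fst) ?lM //.
  by rewrite nth_uniq ?size_map ?lM // => /eqP /val_inj.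
by move=> j; apply: lP.
Qed.

(** After inverting y modulo [J], this says that w/y - a is not invertible for some a. If all were
    invertible, uncountability would give arbitrarily many a whose inverses have numerators of
    bounded degree over the same power of y. These are linearly dependent, so a product of factors w
    - b y times a power of y lies in [J]; removing the factors one by one puts a power of y in
    [J]. *)
Lemma ideal_add_linear (J : A -> Prop) (y w : A) : is_ideal J -> (forall t, ~ J (y ^+ t)) ->
  exists a : F, forall t g, ~ J (y ^+ t - g * (w - a%:MP * y)).
Proof.
move=> HJ Jy; have [J0 [JD JM]] := HJ; apply: NNPP => no.
have inv a : exists t g, J (y ^+ t - g * (w - a%:MP * y)).
  apply: NNPP => h; apply: no; exists a => t g hJ; apply: h; by exists t, g.
have y0 : y != 0 by apply/eqP => e; apply: (Jy 1%N); rewrite expr1 e.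
pose P (k : nat * nat) a :=
  exists g : A, (msize g <= k.2)%N /\ J (y ^+ k.1 - g * (w - a%:MP * y)).
have [[t s] hts] : exists k, forall E : seq F, exists2 a, P k a & a \notin E.
  apply: uncountable_fiber => a; have [t [g hg]] := inv a.
  by exists (t, msize g), g.
pose M := #|{: 'X_{1..n < s}}|.+1.
have [a [g [a_inj hg]]] := distinct_choices hts M.
have [c [[j cj] dep]] := linear_dependence (fun j => proj1 (hg j)) (ltnSn _).
have [rs [l l0 split]] := split_binary_form w y0 a_inj cj.
pose u k := w - (a k)%:MP * y.
have h1 : J (y ^+ t * \sum_j (c j)%:MP * \prod_(k | k != j) u k).
  (* Subtracting the terms g_j u_j changes the sum by the product of all [u k] times the dependence
     relation, that is, by 0. *)
  have -> : y ^+ t * (\sum_j (c j)%:MP * \prod_(k | k != j) u k) =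
      \sum_j ((c j)%:MP * \prod_(k | k != j) u k) * (y ^+ t - g j * u j).
    transitivity (\sum_j ((c j)%:MP * \prod_(k | k != j) u k) * (y ^+ t - g j * u j) +
        (\sum_j (c j)%:MP * g j) * \prod_k u k); last by rewrite dep mul0r addr0.
    rewrite mulr_sumr mulr_suml -big_split; apply: eq_bigr => i _ /=.
    rewrite [\prod_k u k](bigD1 i) //=; ring.
  by apply: ideal_sum => // i _; apply: JM; case: (hg i).
have h2 : exists e, J (y ^+ e * \prod_(b <- rs) (w - b%:MP * y)).
  exists (t + M.-1)%N.
  have ll : (l^-1)%:MP * l%:MP = 1 :> A by rewrite -mpolyCM mulVf.
  have -> : y ^+ (t + M.-1) * (\prod_(b <- rs) (w - b%:MP * y)) =
      (l^-1)%:MP * y ^+ size rs * (y ^+ t * \sum_j (c j)%:MP * \prod_(k | k != j) u k).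
    transitivity ((l^-1)%:MP * y ^+ t *
      (y ^+ size rs * \sum_j (c j)%:MP * \prod_(k | k != j) u k)); last by ring.
    rewrite split exprD -[LHS]mul1r -ll; ring.
  exact: JM.
(* Modulo [J], some power of y is a multiple of w - b y, so each linear factor is traded for a power
   of y. *)
move: h2; elim: rs {split} => [|b rs IH] [e].
  by rewrite big_nil mulr1; apply: Jy.
rewrite big_cons => h; apply: IH.
have [t' [g' hb]] := inv b; exists (e + t')%N.
have -> : y ^+ (e + t') * (\prod_(b <- rs) (w - b%:MP * y)) =
   (y ^+ e * \prod_(b <- rs) (w - b%:MP * y)) * (y ^+ t' - g' * (w - b%:MP * y)) +
   g' * (y ^+ e * ((w - b%:MP * y) * \prod_(b <- rs) (w - b%:MP * y))).
  by rewrite exprD; ring.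
by apply: JD; apply: JM.
Qed.

End Step.
End Nullstellensatz.

(** * The projective Nullstellensatz *)

Section Macaulay.

From mathcomp Require Import ring.

Local Open Scope ring_scope.

Section CommonZero.

Variables (F : closedFieldType).
Hypothesis uncountable : forall E : nat -> seq F, exists a, forall s, a \notin E s.

(** One application of [ideal_add_linear] per coordinate: each adjoins a linear form and keeps the
    powers of x_i0 outside. Together the linear forms cut out a single projective point. *)
Lemma ideal_point n (J : {mpoly F[n]} -> Prop) (i0 : 'I_n) :
  is_ideal J -> (forall t, ~ J ('X_i0 ^+ t)) ->
  exists a : 'I_n -> F, exists J' : {mpoly F[n]} -> Prop,
    [/\ is_ideal J', forall f, J f -> J' f, forall t, ~ J' ('X_i0 ^+ t) &
        forall i, J' ('X_i - (a i)%:MP * 'X_i0)].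
Proof.
move=> HJ Jy.
have [J' [HJ' JJ' J'y hl]] : exists J' : {mpoly F[n]} -> Prop,
    [/\ is_ideal J', forall f, J f -> J' f, forall t, ~ J' ('X_i0 ^+ t) &
        forall i, i \in enum 'I_n -> exists a : F, J' ('X_i - a%:MP * 'X_i0)].
  elim: (enum 'I_n) => [|i l [J1 [HJ1 JJ1 J1y hl]]]; first by exists J.
  have [a ha] := ideal_add_linear uncountable 'X_i HJ1 J1y.
  have [J0 [JD JM]] := HJ1.
  exists (fun f => exists g, J1 (f - g * ('X_i - a%:MP * 'X_i0))); split.
  - split; [|split].
    + by exists 0; rewrite mul0r subr0.
    + move=> f1 f2 [g1 h1] [g2 h2]; exists (g1 + g2).
      by rewrite mulrDl opprD addrACA; apply: JD.
    + move=> h f [g hg]; exists (h * g).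
      by rewrite -mulrA -mulrBr; apply: JM.
  - by move=> f /JJ1 hf; exists 0; rewrite mul0r subr0.
  - by move=> t [g hg]; apply: (ha t g).
  - move=> k; rewrite inE => /orP[/eqP ->|/hl [b hb]].
      by exists a, 1; rewrite mul1r subrr.
    by exists b, 0; rewrite mul0r subr0.
have [a ha] := fin_all_exists (fun i => hl i (mem_enum 'I_n i)).
by exists a, J'.
Qed.

Definition mnm_of N d (m : mon N d) : 'X_{1..N.+1} :=
  [multinom (val m i : nat) | i < N.+1].

Definition form N d (S : comRingType) (H : hmap S N d) (j : 'I_N.+1) : {mpoly S[N.+1]} :=
  \sum_(m : mon N d) (H j m)%:MP * 'X_[mnm_of m].

Lemma mdeg_mnm_of N d (m : mon N d) : mdeg (mnm_of m) = d.
Proof. by rewrite mdegE -[RHS](eqP (valP m)); apply: eq_bigr => i _; rewrite mnmE. Qed.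

Lemma mon_prod_const N d (S : comRingType) (m : mon N d) (y : S) :
  \prod_(i < N.+1) y ^+ (val m i : nat) = y ^+ d.
Proof. by rewrite prodrXr (eqP (valP m)). Qed.

Lemma ideal_congr_prod (A : comRingType) (J : A -> Prop) (I : Type) (r : seq I) (f g : I -> A) :
  is_ideal J -> (forall i, J (f i - g i)) ->
  J (\prod_(i <- r) f i - \prod_(i <- r) g i).
Proof.
move=> [J0 [JD JM]] h; elim/big_rec2: _ => [|i x y _ IH]; first by rewrite subrr.
have -> : f i * y - g i * x = f i * (y - x) + x * (f i - g i) by ring.
by apply: JD; apply: JM.
Qed.

Lemma ideal_congr_exp (A : comRingType) (J : A -> Prop) (f g : A) k :
  is_ideal J -> J (f - g) -> J (f ^+ k - g ^+ k).
Proof. by move=> [_ [_ JM]] h; rewrite subrXX mulrC; apply: JM. Qed.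

(** Modulo the enlarged ideal x_i is a_i x_i0, so [form H j] becomes H_j(a) x_i0^d. If H_j(a) were
    nonzero, x_i0^d would lie in the ideal; if a_i0 were zero, x_i0 would. *)
Lemma common_zero_of_ideal N d (H : hmap F N d) (J : {mpoly F[N.+1]} -> Prop) i0 :
  is_ideal J -> (forall j, J (form H j)) -> (forall t, ~ J ('X_i0 ^+ t)) ->
  exists x : vec F N, x i0 != 0 /\ forall j, heval H x j = 0.
Proof.
move=> HJ HH Jy; have [a [J' [HJ' JJ' J'y ha]]] := ideal_point HJ Jy.
have [J0 [JD JM]] := HJ'.
exists a; split.
  apply/eqP => a0; apply: (J'y 1%N); have := ha i0.
  by rewrite a0 mpolyC0 mul0r subr0 expr1.
move=> j; apply/eqP/negPn/negP => nz; apply: (J'y d).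
have congr_form : J' (form H j - (heval H a j)%:MP * 'X_i0 ^+ d).
  have -> : (heval H a j)%:MP * 'X_i0 ^+ d =
      \sum_(m : mon N d) (H j m)%:MP * \prod_(i < N.+1) ((a i)%:MP * 'X_i0) ^+ val m i.
    rewrite /heval raddf_sum mulr_suml; apply: eq_bigr => m _ /=.
    rewrite mpolyCM -mulrA; congr (_ * _).
    rewrite -(mon_prod_const m) rmorph_prod -big_split; apply: eq_bigr => i _ /=.
    by rewrite exprMn rmorphXn.
  rewrite /form -sumrB; apply: ideal_sum => // m _; rewrite -mulrBr; apply: JM.
  have -> : 'X_[mnm_of m] = \prod_(i < N.+1) 'X_i ^+ (val m i : nat) :> {mpoly F[N.+1]}.
    by rewrite mpolyXE_id; apply: eq_bigr => i _; rewrite mnmE.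
  by apply: ideal_congr_prod => // i; apply: ideal_congr_exp.
have h := JJ' _ (HH j).
have := ideal_sub HJ' h congr_form; rewrite subKr => /(JM ((heval H a j)^-1)%:MP).
by rewrite mulrA -mpolyCM mulVf // mul1r.
Qed.

(** A coordinate with no power in the ideal would produce a common zero, so x_i^(t_i) lies in it for
    each i. A monomial of degree at least the sum of the t_i is divisible by one of these powers. *)
Lemma forms_ideal_full N d (H : hmap F N d) : no_common_zero H ->
  exists t : nat, forall m : 'X_{1..N.+1}, (t <= mdeg m)%N ->
    exists g : 'I_N.+1 -> {mpoly F[N.+1]}, 'X_[m] = \sum_j g j * form H j.
Proof.
move=> nz.
pose J f := exists g : 'I_N.+1 -> {mpoly F[N.+1]}, f = \sum_j g j * form H j.
have HJ : is_ideal J.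
  split; [|split].
  - by exists (fun=> 0); rewrite big1 // => j _; rewrite mul0r.
  - move=> _ _ [g1 ->] [g2 ->]; exists (fun j => g1 j + g2 j).
    by rewrite -big_split; apply: eq_bigr => j _; rewrite mulrDl.
  - move=> h _ [g ->]; exists (fun j => h * g j).
    by rewrite mulr_sumr; apply: eq_bigr => j _; rewrite mulrA.
have HH j : J (form H j).
  exists (fun k => (k == j)%:R); rewrite (bigD1 j) //= eqxx mul1r big1 ?addr0 // => k.
  by move=> /negPf ->; rewrite mul0r.
have pow i : exists t, J ('X_i ^+ t).
  apply: NNPP => no.
  have [|x [xi hx]] := common_zero_of_ideal (i0 := i) HJ HH.
    by move=> t h; apply: no; exists t.
  have [|j] := nz x; first by exists i.
  by rewrite hx eqxx.
have [t ht] := fin_all_exists pow.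
exists (\sum_i t i)%N => m; rewrite mdegE => le; have [_ [_ JM]] := HJ.
have [i ti] : exists i, (t i <= m i)%N.
  apply/existsP; rewrite -[X in is_true X]negbK; apply/negP => /existsPn h.
  move: le; apply/negP; rewrite -ltnNge (bigD1 ord0) //= [X in (_ < X)%N](bigD1 ord0) //=.
  rewrite -addSn leq_add //; first by rewrite ltnNge h.
  by apply: leq_sum => i _; rewrite ltnW // ltnNge h.
have -> : m = ((m - U_(i) *+ t i) + U_(i) *+ t i)%MM.
  apply/mnmP => k; rewrite mnmDE mnmBE mulmnE mnm1E; case: eqP => [<-|_].
    by rewrite mul1n subnK.
  by rewrite mul0n subn0 addn0.
by rewrite mpolyXD -mpolyXn; apply: JM.
Qed.

End CommonZero.

(** * Macaulay matrices and nonvanishing of the resultant *)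

Section Matrix.

Variables (N e d : nat).

Lemma mon_add_lt (m : mon N e) (m' : mon N d) i : (val m i + val m' i < (e + d).+1)%N.
Proof. by rewrite ltnS leq_add // -ltnS. Qed.

Definition mon_add_val (m : mon N e) (m' : mon N d) : {ffun 'I_N.+1 -> 'I_(e + d).+1} :=
  [ffun i => Ordinal (mon_add_lt m m' i)].

Lemma mon_add_subproof (m : mon N e) (m' : mon N d) :
  (\sum_(i < N.+1) (mon_add_val m m' i : nat))%N == (e + d)%N.
Proof.
under eq_bigr do rewrite ffunE /=.
by rewrite big_split /= (eqP (valP m)) (eqP (valP m')).
Qed.

Definition mon_add (m : mon N e) (m' : mon N d) : mon N (e + d) :=
  exist _ (mon_add_val m m') (mon_add_subproof m m').

(** Row (j, m') lists the coefficients of x^m' H_j on the monomials of degree e + d. The sum has at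
    most one term, since m' + m determines m. *)
Definition macaulay (S : comRingType) (H : hmap S N d) :
    'M[S]_(#|{: 'I_N.+1 * mon N e}|, #|{: mon N (e + d)}|) :=
  \matrix_(r, c) \sum_(m : mon N d | mon_add (enum_val r).2 m == enum_val c)
    H (enum_val r).1 m.

Lemma macaulay_mul (S : comRingType) (H : hmap S N d)
  (v : 'cV[S]_(#|{: mon N (e + d)}|)) r :
  (macaulay H *m v) r 0 =
  \sum_(m : mon N d) H (enum_val r).1 m * v (enum_rank (mon_add (enum_val r).2 m)) 0.
Proof.
rewrite mxE; under eq_bigr do rewrite mxE mulr_suml.
rewrite (exchange_big_dep predT) //=; apply: eq_bigr => m _.
rewrite (big_pred1 (enum_rank (mon_add (enum_val r).2 m))) // => c /=.
by rewrite -[in RHS](inj_eq enum_val_inj) enum_rankK eq_sym.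
Qed.

Lemma mon_add_prod (S : comRingType) (m : mon N e) (m' : mon N d) (x : vec S N) :
  \prod_(i < N.+1) x i ^+ (val (mon_add m m') i : nat) =
  (\prod_(i < N.+1) x i ^+ (val m i : nat)) * \prod_(i < N.+1) x i ^+ (val m' i : nat).
Proof. by rewrite -big_split; apply: eq_bigr => i _; rewrite /= ffunE exprD. Qed.

(** Against the vector of monomials in [x], row (j, m') evaluates to x^m' H_j(x). *)
Lemma macaulay_zero (S : comRingType) (H : hmap S N d) (x : vec S N) :
  (forall j, heval H x j = 0) ->
  macaulay H *m
    (\col_c \prod_(i < N.+1) x i ^+ (val (enum_val c : mon N (e + d)) i : nat)) = 0.
Proof.
move=> hx; apply/colP => r; rewrite macaulay_mul mxE.
transitivity (\prod_(i < N.+1) x i ^+ (val (enum_val r).2 i : nat) * heval H x (enum_val r).1).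
  rewrite /heval mulr_sumr; apply: eq_bigr => m _.
  by rewrite mxE enum_rankK mon_add_prod mulrCA.
by rewrite hx mulr0.
Qed.

Lemma map_macaulay (S T : comRingType) (f : {rmorphism S -> T}) (H : hmap S N d) :
  map_mx f (macaulay H) = macaulay (fun j m => f (H j m)).
Proof. by apply/matrixP => r c; rewrite !mxE rmorph_sum. Qed.

Lemma mnm_of_add (m : mon N e) (m' : mon N d) :
  mnm_of (mon_add m m') = (mnm_of m + mnm_of m')%MM.
Proof. by apply/mnmP => i; rewrite mnmDE !mnmE /= ffunE. Qed.

End Matrix.

Lemma mnm_of_inj N d : injective (@mnm_of N d).
Proof.
move=> m m' h; apply/val_inj/ffunP => i; apply/val_inj.
by have := congr1 (fun k : 'X_{1..N.+1} => k i) h; rewrite !mnmE.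
Qed.

Lemma mnm_of_surj N d (m : 'X_{1..N.+1}) : mdeg m = d -> exists m' : mon N d, mnm_of m' = m.
Proof.
move=> md.
have lt i : (m i < d.+1)%N by rewrite ltnS -md mdegE (bigD1 i) //= leq_addr.
pose f : {ffun 'I_N.+1 -> 'I_d.+1} := [ffun i => Ordinal (lt i)].
have pf : (\sum_(i < N.+1) (f i : nat))%N == d.
  by rewrite -[X in _ == X]md mdegE; apply/eqP/eq_bigr => i _; rewrite ffunE.
by exists (exist _ f pf : mon N d); apply/mnmP => i; rewrite mnmE /= ffunE.
Qed.

Section Functional.

Variables (F : fieldType) (N t : nat) (v : mon N t -> F).

(** The values [v] on monomials of degree [t] are extended linearly, and by 0 to all other
    degrees. *)
Definition top_functional (f : {mpoly F[N.+1]}) : F :=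
  \sum_(m : mon N t) f@_(mnm_of m) * v m.

Lemma top_functional_sum (I : Type) (r : seq I) (P : pred I) (f : I -> {mpoly F[N.+1]}) :
  top_functional (\sum_(i <- r | P i) f i) = \sum_(i <- r | P i) top_functional (f i).
Proof.
rewrite /top_functional exchange_big; apply: eq_bigr => m _.
by rewrite raddf_sum mulr_suml.
Qed.

Lemma top_functionalC c f : top_functional (c%:MP * f) = c * top_functional f.
Proof.
by rewrite /top_functional mulr_sumr; apply: eq_bigr => m _; rewrite mcoeffCM mulrA.
Qed.

Lemma top_functionalX m : top_functional 'X_[mnm_of m] = v m.
Proof.
rewrite /top_functional (bigD1 m) //= mcoeffX eqxx mul1r big1 ?addr0 // => m' /negPf mm'.
by rewrite mcoeffX (inj_eq (@mnm_of_inj _ _)) eq_sym mm' mul0r.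
Qed.

Lemma top_functional_deg m : mdeg m != t -> top_functional 'X_[m] = 0.
Proof.
move=> mt; rewrite /top_functional big1 // => m' _; rewrite mcoeffX.
by case: eqP => [e|_]; [rewrite e mdeg_mnm_of eqxx in mt | rewrite mul0r].
Qed.

End Functional.

(* A vector killed by the Macaulay matrix is a functional on forms of degree
   e + d that kills the ideal of the system, hence all monomials. *)
Lemma macaulay_row_full (F : closedFieldType) N d (H : hmap F N d) :
  (forall E : nat -> seq F, exists a, forall s, a \notin E s) ->
  no_common_zero H -> exists e, row_full (macaulay e H).
Proof.
move=> unc nz; have [e he] := forms_ideal_full unc nz.
(* From degree e on all monomials lie in the ideal, in particular those of degree e + d. Full column
   rank is a zero cokernel, and each cokernel column is killed by the matrix. *)
exists e; rewrite -cokermx_eq0; apply/eqP/matrixP => c k; rewrite [RHS]mxE.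
pose v (m : mon N (e + d)) : F := cokermx (macaulay e H) (enum_rank m) k.
have ker (r : 'I_#|{: 'I_N.+1 * mon N e}|) :
    \sum_(m : mon N d) H (enum_val r).1 m * v (mon_add (enum_val r).2 m) = 0.
  have := macaulay_mul H (col k (cokermx (macaulay e H))) r.
  have -> : macaulay e H *m col k (cokermx (macaulay e H)) = 0.
    by rewrite colE mulmxA mulmx_coker mul0mx.
  rewrite mxE => /esym.
  by under eq_bigr do rewrite mxE.
have kill m j : top_functional v ('X_[m] * form H j) = 0.
  rewrite /form mulr_sumr top_functional_sum.
  under eq_bigr do rewrite mulrCA top_functionalC -mpolyXD.
  (* For a monomial of degree e this is a row of the kernel relation; any other degree gives
     products outside degree e + d. *)
  case: (eqVneq (mdeg m) e) => [/mnm_of_surj [m' <-]|me].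
    have := ker (enum_rank (j, m')); rewrite enum_rankK /= => ker'.
    rewrite -[RHS]ker'; apply: eq_bigr => m'' _.
    by rewrite -mnm_of_add top_functionalX.
  rewrite big1 // => m'' _; rewrite top_functional_deg ?mulr0 //.
  by rewrite mdegD mdeg_mnm_of eqn_add2r.
have -> : cokermx (macaulay e H) c k = v (enum_val c) by rewrite /v enum_valK.
rewrite -(top_functionalX v); have [|g ->] := he (mnm_of (enum_val c)).
  by rewrite mdeg_mnm_of leq_addr.
rewrite top_functional_sum big1 // => j _.
rewrite [g j]mpolyE mulr_suml top_functional_sum big1 // => m _.
by rewrite -mul_mpolyC -mulrA top_functionalC kill mulr0.
Qed.

(** A maximal minor that is nonzero at [H] is an integer polynomial in the universal coefficients.
    Over [algC] it vanishes with the resultant, hence by [vanishing_transfer] also over [F]; so a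
    zero resultant would contradict the choice of the minor. *)
Lemma resultant_neq0 (F : closedFieldType) N d (Rz : {mpoly int[ncoef N d]}) (H : hmap F N d) :
  (forall E : nat -> seq F, exists a, forall s, a \notin E s) ->
  is_macaulay_resultant Rz -> no_common_zero H -> ev (coefvec H) Rz <> 0.
Proof.
move=> unc [_ [Rstd Rzero]] nz; have [e full] := macaulay_row_full unc nz.
pose f := fullrankfun full.
pose Hu : hmap {mpoly int[ncoef N d]} N d := fun j m => 'X_(enum_rank (j, m)).
pose minor (S : comRingType) (G : hmap S N d) := \det (rowsub f (macaulay e G)).
have ev_minor (S : comRingType) (c : 'I_(ncoef N d) -> S) :
    ev c (minor _ Hu) = minor S (fun j m => c (enum_rank (j, m))).
  rewrite /ev -[mmap _ _ _]/((mmap intr c : {rmorphism _ -> _}) _).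
  rewrite /minor -det_map_mx map_mxsub map_macaulay; congr (\det (rowsub f _)).
  by apply/matrixP => r k; rewrite !mxE; apply: eq_bigr => m _; rewrite /= mmapX mmap1U.
move=> R0.
have : ev (coefvec H) (minor _ Hu) = 0.
  apply: (vanishing_transfer Rstd) R0 => c.
  pose G : hmap algC N d := fun j m => c (enum_rank (j, m)).
  have -> : ev c Rz = ev (coefvec G) Rz.
    by apply: ev_ext => k; rewrite /coefvec /G -surjective_pairing enum_valK.
  rewrite -ev_map_mpoly => /(Rzero G) [z [[i zi] hz]].
  rewrite ev_minor -/G /minor -det_tr; apply/eqP/det0P.
  (* The monomials of degree e + d at the common zero [z] form a kernel vector, nonzero because
     z_i^(e + d) is one of its entries. *)
  pose w : 'cV[algC]_(#|{: mon N (e + d)}|) :=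
    \col_c \prod_(i < N.+1) z i ^+ (val (enum_val c : mon N (e + d)) i : nat).
  exists w^T.
    apply/negP => /eqP /(congr1 (fun B : 'rV_ _ => B 0 (enum_rank (pure_power (e + d) i)))).
    rewrite !mxE enum_rankK pure_power_prod => /eqP.
    by rewrite expf_eq0 (negPf zi) andbF.
  rewrite -trmx_mul; apply/eqP; rewrite -[0]trmx0 (inj_eq trmx_inj); apply/eqP.
  by rewrite mul_rowsub_mx macaulay_zero // ; apply/matrixP => r k; rewrite !mxE.
apply/eqP; rewrite ev_minor.
have -> : minor F (fun j m => coefvec H (enum_rank (j, m))) = minor F H.
  congr (\det (rowsub f _)); apply/matrixP => r k; rewrite !mxE.
  by apply: eq_bigr => m _; rewrite /coefvec enum_rankK.
by have := fullrowsub_unit full; rewrite unitmxE unitfE.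
Qed.

End Macaulay.

(** * Two lifts of one morphism differ by a constant factor *)

Section ProportionalLifts.

From mathcomp Require Import ring.

Local Open Scope ring_scope.

Lemma heval_scale N d (S : comRingType) (H : hmap S N d) (c : S) (x : vec S N) i :
  heval H (fun j => c * x j) i = c ^+ d * heval H x i.
Proof.
rewrite /heval mulr_sumr; apply: eq_bigr => m _; rewrite mulrCA; congr (_ * _).
by rewrite -(mon_prod_const m) -big_split; apply: eq_bigr => j _; rewrite exprMn.
Qed.

Variables (F : closedFieldType).

(** Algebraic closedness suffices: [p + 1] takes only the value 1, so it has no root and is
    constant. *)
Lemma poly_eq0_of_horner (p : {poly F}) : (forall t, p.[t] = 0) -> p = 0.
Proof.
move=> h.
have noroot t : ~~ root (p + 1) t by rewrite /root hornerD h hornerC add0r oner_neq0.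
have : size (p + 1) == 1%N.
  by apply/negPn/negP => /closed_rootP [t rt]; have := noroot t; rewrite rt.
move=> /size_poly1P [c _ pc].
have := congr1 (fun q => q.[0]) pc; rewrite hornerD h !hornerC add0r => c1.
by apply: (addIr 1); rewrite pc -c1 add0r.
Qed.

(* The ratio g_i / f_i in lowest terms has no zero and no pole. *)
Lemma proportional_polys (I : Type) (f g : I -> {poly F}) (i0 : I) : f i0 != 0 ->
  (forall t, exists i, (f i).[t] != 0) -> (forall t, exists i, (g i).[t] != 0) ->
  (forall i j, g i * f j = g j * f i) -> exists l : F, forall j, g j = l *: f j.
Proof.
move=> fi0 hf hg e.
have cop : coprimep (f i0 %/ gcdp (f i0) (g i0)) (g i0 %/ gcdp (f i0) (g i0)).
  by apply: coprimep_div_gcd; rewrite fi0.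
have pE := divpK (dvdp_gcdl (f i0) (g i0)); have qE := divpK (dvdp_gcdr (f i0) (g i0)).
set a := gcdp _ _ in cop pE qE; set p := _ %/ a in cop pE; set q := _ %/ a in cop qE.
have a0 : a != 0 by apply: contraNneq fi0 => a0; rewrite -pE a0 mulr0.
have pq j : q * f j = g j * p.
  by apply: (mulIf a0); rewrite mulrAC qE e -mulrA pE.
(* A root of a common divisor would be a common root of all [h i], so such a divisor is a nonzero
   constant. *)
have const (s : {poly F}) (h : I -> {poly F}) : (forall t, exists i, (h i).[t] != 0) ->
    (forall j, s %| h j) -> exists2 c, c != 0 & s = c%:P.
  move=> hh sh; apply/size_poly1P/negPn/negP => /closed_rootP [t rt].
  have [i /negP] := hh t; apply.
  by have := dvdp_trans (_ : 'X - t%:P %| s) (sh i); rewrite !dvdp_XsubCl; apply.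
have [c1 c10 p1] : exists2 c, c != 0 & p = c%:P.
  apply: (const p f hf) => j; rewrite -(Gauss_dvdpr _ cop) pq dvdp_mull //.
have [c2 c20 q1] : exists2 c, c != 0 & q = c%:P.
  apply: (const q g hg) => j; rewrite coprimep_sym in cop.
  by rewrite -(Gauss_dvdpl _ cop) -pq dvdp_mulr.
exists (c2 / c1) => j; apply: (@mulIf _ c1%:P); first by rewrite polyC_eq0.
by rewrite -{1}p1 -pq q1 [RHS]mulrC !mul_polyC scalerA mulrC divfK.
Qed.

Variables (N d : nat) (Phi Psi : hmap F N d).

Definition line_vec (x y : vec F N) : vec {poly F} N :=
  fun j => (x j)%:P + (y j)%:P * 'X.

Definition line_forms (H : hmap F N d) (x y : vec F N) (i : 'I_N.+1) : {poly F} :=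
  heval (fun i m => (H i m)%:P) (line_vec x y) i.

Lemma horner_line_forms H x y i t :
  (line_forms H x y i).[t] = heval H (fun j => x j + y j * t) i.
Proof.
rewrite /line_forms -[LHS]/(horner_eval t _) heval_morph; apply: heval_ext => [j m|j].
  by rewrite /= /horner_eval hornerC.
by rewrite /= /horner_eval /line_vec hornerD hornerM !hornerC hornerX.
Qed.

(** A priori the factor depends on the point. Along the line from x to y both lifts become
    polynomial tuples in one variable without common zero, and [proportional_polys] makes the factor
    constant. *)
Lemma lifts_proportional : no_common_zero Phi -> is_lift_of Phi Psi ->
  exists2 c : F, c != 0 &
    forall x, nonzero_vec x -> forall i, heval Psi x i = c * heval Phi x i.
Proof.
move=> nzPhi [nzPsi prop].
have step (x y : vec F N) (c : F) : nonzero_vec x -> nonzero_vec y ->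
    (forall i, heval Psi x i = c * heval Phi x i) ->
    forall i, heval Psi y i = c * heval Phi y i.
  move=> hx hy cx.
  pose w : vec F N := fun j => y j - x j.
  (* If the line meets the origin, y is a multiple of x and homogeneity is enough. *)
  case: (classic (exists t, forall j, x j + w j * t = 0)) => [[t dep]|indep].
    have t0 : t != 0.
      apply/eqP => t0; have [j] := hx; have := dep j.
      by rewrite t0 mulr0 addr0 => ->; rewrite eqxx.
    have yx j : y j = ((t - 1) / t) * x j.
      apply: (mulIf t0); rewrite mulrAC divfK //; apply/eqP; rewrite -subr_eq0.
      by apply/eqP; rewrite -[RHS](dep j) /w; ring.
    move=> i; rewrite !(heval_ext i (fun j m => erefl) yx) !heval_scale cx.
    by rewrite mulrCA.
  have hline t : nonzero_vec (fun j => x j + w j * t).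
    apply: NNPP => h; apply: indep; exists t => j; apply/eqP/negPn/negP => hj.
    by apply: h; exists j.
  have [i0 fi0] := nzPhi x hx.
  have at0 H i : (line_forms H x w i).[0] = heval H x i.
    by rewrite horner_line_forms; apply: heval_ext => // j; rewrite mulr0 addr0.
  have [l hl] : exists l : F, forall j, line_forms Psi x w j = l *: line_forms Phi x w j.
    apply: (@proportional_polys _ _ _ i0).
    - by apply: contraNneq fi0 => f0; rewrite -at0 f0 horner0.
    - by move=> t; have [i hi] := nzPhi _ (hline t); exists i; rewrite horner_line_forms.
    - by move=> t; have [i hi] := nzPsi _ (hline t); exists i; rewrite horner_line_forms.
    - move=> i j; apply/eqP; rewrite -subr_eq0; apply/eqP/poly_eq0_of_horner => t.
      rewrite hornerD hornerN !hornerM !horner_line_forms.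
      by have [a [_ ha]] := prop _ (hline t); rewrite !ha; ring.
  have cl : c = l.
    apply: (mulIf fi0); rewrite -cx -(at0 Psi) -(at0 Phi).
    by rewrite hl hornerZ.
  have at1 H i : (line_forms H x w i).[1] = heval H y i.
    by rewrite horner_line_forms; apply: heval_ext => // j; rewrite mulr1 addrC subrK.
  by move=> i; rewrite -!at1 hl hornerZ cl.
pose e0 : vec F N := fun=> 1.
have he0 : nonzero_vec e0 by exists ord0; rewrite oner_neq0.
have [c [c0 hc]] := prop e0 he0.
by exists c => // x hx; apply: (step e0).
Qed.

End ProportionalLifts.

(** * Maxima over finite types *)

Section MaxOverFinType.

Variables (T : finType) (f : T -> R).

Lemma foldr_Rmax_ge t : f t <= foldr Rmax 0 (map f (enum T)).
Proof.
have : t \in enum T by rewrite mem_enum.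
elim: (enum T) => //= a s IH; rewrite inE => /orP[/eqP ->|/IH h]; first exact: Rmax_l.
by apply: Rle_trans h (Rmax_r _ _).
Qed.

Lemma foldr_Rmax_le b : 0 <= b -> (forall t, f t <= b) -> foldr Rmax 0 (map f (enum T)) <= b.
Proof. by move=> b0 h; elim: (enum T) => //= a s IH; apply: Rmax_lub. Qed.

Lemma foldr_Rmax_attained : (forall t, 0 <= f t) -> T ->
  exists t, f t = foldr Rmax 0 (map f (enum T)).
Proof.
move=> f0 t0; have : t0 \in enum T by rewrite mem_enum.
suff [->|//] : enum T = [::] \/ exists t, f t = foldr Rmax 0 (map f (enum T)) by [].
elim: (enum T) => [|a s [->|[t ht]]]; [by left | right | right] => /=.
  by exists a; rewrite Rmax_left.
rewrite -ht; case: (Rle_dec (f a) (f t)) => h; [exists t | exists a].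
  by rewrite Rmax_right.
by rewrite Rmax_left; lra.
Qed.

End MaxOverFinType.

(** * The sup norm and the chordal distance *)

Section ProjectiveMetric.

Variables (K : fieldType) (abs : K -> R) (Habs : nonarch_abs abs).
Variable N : nat.
Implicit Types x y : vec K N.

Local Notation norm := (vnorm abs).

Lemma norm_ge x i : abs (x i) <= norm x.
Proof. exact: (foldr_Rmax_ge (fun i => abs (x i)) i). Qed.

Lemma norm_le x b : 0 <= b -> (forall i, abs (x i) <= b) -> norm x <= b.
Proof. exact: foldr_Rmax_le. Qed.

Lemma norm_attained x : exists i, abs (x i) = norm x.
Proof. by apply: (foldr_Rmax_attained _ ord0) => i; apply: abs_ge0 Habs _. Qed.

Lemma norm_gt0 x : nonzero_vec x -> 0 < norm x.
Proof.
move=> [i /eqP xi]; apply: Rlt_le_trans (norm_ge x i); exact: abs_gt0 Habs _ xi.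
Qed.

Lemma norm_scale (c : K) x y : (forall i, x i = (c * y i)%R) -> norm x = abs c * norm y.
Proof.
move=> e; have c0 := abs_ge0 Habs c.
have [j hj] := norm_attained y.
apply: Rle_antisym.
  apply: norm_le => [|i].
    by apply: Rmult_le_pos => //; rewrite -hj; apply: abs_ge0 Habs _.
  by rewrite e (absM Habs); apply: Rmult_le_compat_l (norm_ge y i).
by rewrite -hj -(absM Habs) -e; apply: norm_ge.
Qed.

Definition wedge_norm x y : R :=
  foldr Rmax 0
     (map (fun ij : 'I_N.+1 * 'I_N.+1 => abs (x ij.1 * y ij.2 - x ij.2 * y ij.1)%R)
          (enum {: 'I_N.+1 * 'I_N.+1})).

Lemma chordalE x y : chordal abs x y = wedge_norm x y / (norm x * norm y).
Proof. by []. Qed.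

Lemma wedge_norm_ge x y i j : abs (x i * y j - x j * y i)%R <= wedge_norm x y.
Proof.
exact: (foldr_Rmax_ge (fun ij : 'I_N.+1 * 'I_N.+1 =>
  abs (x ij.1 * y ij.2 - x ij.2 * y ij.1)%R) (i, j)).
Qed.

Lemma wedge_norm_le x y b : 0 <= b ->
  (forall i j, abs (x i * y j - x j * y i)%R <= b) -> wedge_norm x y <= b.
Proof. by move=> b0 h; apply: foldr_Rmax_le => // -[i j]. Qed.

Lemma wedge_norm_ge0 x y : 0 <= wedge_norm x y.
Proof. by apply: Rle_trans (wedge_norm_ge x y ord0 ord0); apply: abs_ge0 Habs _. Qed.

Lemma wedge_norm_scale (a b : K) x y x' y' :
  (forall i, x i = (a * x' i)%R) -> (forall i, y i = (b * y' i)%R) ->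
  wedge_norm x y = abs a * abs b * wedge_norm x' y'.
Proof.
move=> ex ey.
have p : 0 <= abs a * abs b by rewrite -(absM Habs); apply: abs_ge0 Habs _.
have e i j : abs (x i * y j - x j * y i)%R =
    abs a * abs b * abs (x' i * y' j - x' j * y' i)%R.
  by rewrite -!(absM Habs) !ex !ey; congr abs; rewrite mulrBr; congr (_ - _)%R; apply: mulrACA.
apply: Rle_antisym.
  apply: wedge_norm_le => [|i j]; first exact: Rmult_le_pos (wedge_norm_ge0 _ _).
  by rewrite e; apply: Rmult_le_compat_l (wedge_norm_ge _ _ _ _).
have [[i j] /= hij] := @foldr_Rmax_attained _ (fun ij : 'I_N.+1 * 'I_N.+1 =>
  abs (x' ij.1 * y' ij.2 - x' ij.2 * y' ij.1)%R) (fun _ => abs_ge0 Habs _) (ord0, ord0).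
by rewrite [X in _ * X <= _](esym hij) -e; apply: wedge_norm_ge.
Qed.

Lemma chordal_scale (a b : K) x y x' y' : a <> 0%R -> b <> 0%R ->
  nonzero_vec x' -> nonzero_vec y' ->
  (forall i, x i = (a * x' i)%R) -> (forall i, y i = (b * y' i)%R) ->
  chordal abs x y = chordal abs x' y'.
Proof.
move=> /(abs_gt0 Habs) a0 /(abs_gt0 Habs) b0 /norm_gt0 x0 /norm_gt0 y0 ex ey.
rewrite !chordalE (wedge_norm_scale ex ey) (norm_scale ex) (norm_scale ey).
by field; lra.
Qed.

Lemma chordal_ge0 x y : nonzero_vec x -> nonzero_vec y -> 0 <= chordal abs x y.
Proof.
move=> /norm_gt0 x0 /norm_gt0 y0; rewrite chordalE; apply: Rmult_le_pos (wedge_norm_ge0 _ _) _.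
by apply/Rlt_le/Rinv_0_lt_compat/Rmult_lt_0_compat.
Qed.

Lemma chordal_le x y b : nonzero_vec x -> nonzero_vec y -> 0 <= b ->
  (forall i j, abs (x i * y j - x j * y i)%R <= b * (norm x * norm y)) ->
  chordal abs x y <= b.
Proof.
move=> /norm_gt0 x0 /norm_gt0 y0 b0 h.
have p : 0 < norm x * norm y by apply: Rmult_lt_0_compat.
rewrite chordalE; apply: (Rmult_le_reg_r (norm x * norm y)) => //.
have -> : wedge_norm x y / (norm x * norm y) * (norm x * norm y) = wedge_norm x y.
  by field; lra.
by apply: wedge_norm_le => //; apply: Rmult_le_pos; lra.
Qed.

Lemma chordal_ge x y i j : nonzero_vec x -> nonzero_vec y ->
  abs (x i * y j - x j * y i)%R / (norm x * norm y) <= chordal abs x y.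
Proof.
move=> /norm_gt0 x0 /norm_gt0 y0; rewrite chordalE.
apply: Rmult_le_compat_r (wedge_norm_ge x y i j).
by apply/Rlt_le/Rinv_0_lt_compat/Rmult_lt_0_compat.
Qed.

Lemma chordal_le1 x y : nonzero_vec x -> nonzero_vec y -> chordal abs x y <= 1.
Proof.
move=> hx hy; apply: chordal_le => //; first by lra.
move=> i j; rewrite Rmult_1_l.
by apply: (abs_sub_le Habs); rewrite (absM Habs); apply: Rmult_le_compat;
  try exact: abs_ge0 Habs _; apply: norm_ge.
Qed.

(* Close points have representatives normalized at the same coordinate. *)
Lemma chordal_cases x y : nonzero_vec x -> nonzero_vec y ->
  1 <= chordal abs x y \/
  exists i, [/\ abs (x i) = norm x, abs (y i) = norm y &
    forall k, abs (x k / x i - y k / y i)%R <= chordal abs x y].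
Proof.
move=> hx hy; have x0 := norm_gt0 hx; have y0 := norm_gt0 hy.
have [i xi] := norm_attained x; have [j yj] := norm_attained y.
case: (Rle_lt_or_eq_dec _ _ (norm_ge y i)) => [lt|yi]; last first.
  right; exists i; split=> // k.
  have xi0 : x i <> 0%R by move=> e; move: xi; rewrite e (abs0 Habs); lra.
  have yi0 : y i <> 0%R by move=> e; move: yi; rewrite e (abs0 Habs); lra.
  have -> : (x k / x i - y k / y i = (x k * y i - x i * y k) / (x i * y i))%R.
    rewrite mulrBl -!mulf_div [(y i / y i)%R]divff; last exact/eqP.
    by rewrite [(x i / x i)%R]divff ?mulr1 ?mul1r //; apply/eqP.
  rewrite (absM Habs) (absV Habs); last by apply/eqP; rewrite mulf_neq0 //; apply/eqP.
  by rewrite (absM Habs) xi yi; apply: chordal_ge.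
(* Here |y_i| < |y|, so x_i y_j strictly dominates x_j y_i and this minor has absolute value |x|
   |y|. *)
left; apply: Rle_trans (chordal_ge i j hx hy).
have lt' : abs (x j * y i)%R < abs (x i * y j)%R.
  rewrite !(absM Habs) xi yj; apply: Rle_lt_trans (_ : norm x * abs (y i) < _).
    by apply: Rmult_le_compat_r; [apply: abs_ge0 Habs _ | apply: norm_ge].
  exact: Rmult_lt_compat_l.
have -> : abs (x i * y j - x j * y i)%R = abs (x i * y j)%R.
  by apply: (abs_eq_of_sub_lt Habs); rewrite opprB addrC subrK.
by rewrite (absM Habs) xi yj; apply: Req_le; field; lra.
Qed.

End ProjectiveMetric.

(** * Estimates for a lift with coefficients in the unit ball *)

Section MinimalLift.

Variables (K : fieldType) (abs : K -> R) (Habs : nonarch_abs abs).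
Variables (N d : nat) (Psi : hmap K N d) (Rz : {mpoly int[ncoef N d]}).
Hypothesis Psi_le1 : forall j m, abs (Psi j m) <= 1.
Hypothesis nzPsi : no_common_zero Psi.
Hypothesis Rz_zero_shift : forall i0 (x : vec K N), x i0 = 1%R ->
  ev (coefvec (zero_shift i0 Psi x)) Rz = 0%R.

Local Notation norm := (vnorm abs).
Local Notation r := (abs (ev (coefvec Psi) Rz)).
Hypothesis r_gt0 : 0 < r.

Lemma heval_unit_close e (x y : vec K N) j : 0 <= e ->
  (forall i, unit_close abs e (x i) (y i)) ->
  unit_close abs e (heval Psi x j) (heval Psi y j).
Proof.
move=> e0 h; apply: (unit_close_sum Habs) => // m _; apply: (unit_close_mul Habs).
  exact: (unit_close_refl Habs).
by apply: (unit_close_prod Habs) => // i _; apply: (unit_close_exp Habs).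
Qed.

Lemma heval_le1 (x : vec K N) j : (forall i, abs (x i) <= 1) -> abs (heval Psi x j) <= 1.
Proof.
move=> h.
have hx i : unit_close abs 0 (x i) (x i).
  by apply: (unit_close_refl Habs); [apply: Rle_refl | apply: h].
by case: (heval_unit_close j (Rle_refl 0) hx).
Qed.

Lemma resultant_le1 : r <= 1.
Proof.
have h k : unit_close abs 0 (coefvec Psi k) (coefvec Psi k).
  by apply: (unit_close_refl Habs); [apply: Rle_refl | apply: Psi_le1].
by case: (unit_close_ev Habs Rz (Rle_refl 0) h).
Qed.

(** Passing to [zero_shift] moves coefficients by at most |Psi(x)| and sends the resultant to 0; the
    1-Lipschitz property of [Rz] bounds [r] by that displacement. *)
Lemma resultant_le_heval (x : vec K N) i0 : (forall i, abs (x i) <= 1) -> x i0 = 1%R ->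
  r <= norm (heval Psi x).
Proof.
move=> x1 xi0; pose e := norm (heval Psi x).
have e0 : 0 <= e by apply: Rle_trans (norm_ge abs _ ord0); apply: abs_ge0 Habs _.
have e1 : e <= 1 by apply: norm_le; [apply: Rle_0_1 | move=> j; apply: heval_le1].
have shift0 := Rz_zero_shift xi0.
have close k : unit_close abs e (coefvec Psi k) (coefvec (zero_shift i0 Psi x) k).
  rewrite /coefvec; move: (enum_val k) => [j m] /=; rewrite /zero_shift.
  case: eqP => _; last exact: (unit_close_refl Habs).
  split; [exact: Psi_le1 | split].
    by apply: (abs_sub_le Habs) => //; apply: heval_le1.
  by rewrite opprB addrC subrK; apply: norm_ge.
have [_ [_]] := unit_close_ev Habs Rz e0 close.
by rewrite shift0 subr0.
Qed.

Lemma normalized_le1 (x : vec K N) i : nonzero_vec x -> abs (x i) = norm x ->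
  x i <> 0%R /\ forall k, abs (x k / x i)%R <= 1.
Proof.
move=> /(norm_gt0 Habs) x0 xi.
have xi0 : x i <> 0%R by move=> e; move: xi; rewrite e (abs0 Habs); lra.
split=> // k; rewrite (absM Habs) (absV Habs) // xi.
apply: (Rmult_le_reg_r (norm x)) => //; rewrite Rmult_assoc Rinv_l; last by lra.
by rewrite Rmult_1_r Rmult_1_l; apply: norm_ge.
Qed.

Definition normalize (x : vec K N) (i : 'I_N.+1) : vec K N := fun k => (x k / x i)%R.

Lemma normalizeE (x : vec K N) i : x i <> 0%R -> forall k, x k = (x i * normalize x i k)%R.
Proof. by move=> /eqP xi0 k; rewrite /normalize mulrC divfK. Qed.

Lemma heval_normalize (x : vec K N) i : x i <> 0%R ->
  forall j, heval Psi x j = (x i ^+ d * heval Psi (normalize x i) j)%R.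
Proof.
move=> xi0 j; rewrite -heval_scale; apply: heval_ext => // k.
exact: normalizeE.
Qed.

Lemma norm_heval_normalize (x : vec K N) i : nonzero_vec x -> abs (x i) = norm x ->
  norm (heval Psi x) = norm x ^ d * norm (heval Psi (normalize x i)).
Proof.
move=> hx xi; have [xi0 _] := normalized_le1 hx xi.
by rewrite (norm_scale Habs (heval_normalize xi0)) (absX Habs) xi.
Qed.

Lemma norm_heval_bounds (x : vec K N) : nonzero_vec x ->
  r * norm x ^ d <= norm (heval Psi x) <= norm x ^ d.
Proof.
move=> hx; have [i xi] := norm_attained Habs x; have [xi0 le1] := normalized_le1 hx xi.
have p : 0 < norm x ^ d by apply/pow_lt/(norm_gt0 Habs).
rewrite (norm_heval_normalize hx xi).
have h1 : r <= norm (heval Psi (normalize x i)).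
  by apply: (resultant_le_heval (i0 := i)) => //; rewrite /normalize divff //; apply/eqP.
have h2 : norm (heval Psi (normalize x i)) <= 1.
  by apply: norm_le => [|j]; [apply: Rle_0_1 | apply: heval_le1].
nra.
Qed.

Lemma normalize_unit_close (x y : vec K N) i : nonzero_vec x -> nonzero_vec y ->
  abs (x i) = norm x -> abs (y i) = norm y ->
  (forall k, abs (x k / x i - y k / y i)%R <= chordal abs x y) ->
  forall j, unit_close abs (chordal abs x y)
    (heval Psi (normalize x i) j) (heval Psi (normalize y i) j).
Proof.
move=> hx hy xi yi h j; apply: heval_unit_close; first exact: (chordal_ge0 Habs).
have [_ lex] := normalized_le1 hx xi; have [_ ley] := normalized_le1 hy yi.
by move=> k; split; [exact: lex | split; [exact: ley | exact: h]].
Qed.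

(** After normalization the two values differ by less than [r] in every coordinate, while their
    largest coordinates have size at least [r]. By the isosceles property these keep their size. *)
Lemma norm_heval_locally_constant (x y : vec K N) : nonzero_vec x -> nonzero_vec y ->
  chordal abs x y < r ->
  norm (heval Psi x) * norm y ^ d = norm (heval Psi y) * norm x ^ d.
Proof.
move=> hx hy lt; have r1 := resultant_le1.
case: (chordal_cases Habs hx hy) => [|[i [xi yi h]]]; first by lra.
have close := normalize_unit_close hx hy xi yi h.
rewrite (norm_heval_normalize hx xi) (norm_heval_normalize hy yi).
suff -> : norm (heval Psi (normalize x i)) = norm (heval Psi (normalize y i)) by ring.
have half (x' y' : vec K N) : nonzero_vec x' -> abs (x' i) = norm x' ->
    (forall j, abs (heval Psi (normalize x' i) j - heval Psi (normalize y' i) j)%R < r) ->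
    norm (heval Psi (normalize x' i)) <= norm (heval Psi (normalize y' i)).
  move=> hx' xi' lt'; have [xi0 le1] := normalized_le1 hx' xi'.
  have [j hj] := norm_attained Habs (heval Psi (normalize x' i)).
  have rj : r <= abs (heval Psi (normalize x' i) j).
    rewrite hj; apply: (resultant_le_heval (i0 := i)) => //.
    by rewrite /normalize divff //; apply/eqP.
  rewrite -hj -(abs_eq_of_sub_lt Habs (Rlt_le_trans _ _ _ (lt' j) rj)); exact: norm_ge.
apply: Rle_antisym; apply: half => // j; have [_ [_ c]] := close j.
  by apply: Rle_lt_trans c lt.
by rewrite (abs_subC Habs); apply: Rle_lt_trans c lt.
Qed.

(** For normalized representatives the minors of the values are at most the distance of [x] and [y],
    and each norm in the denominator is at least [r]. At distance 1 or more the bound is trivial, as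
    1/r^2 >= 1. *)
Lemma chordal_heval_le (x y : vec K N) : nonzero_vec x -> nonzero_vec y ->
  chordal abs (heval Psi x) (heval Psi y) <= / r ^ 2 * chordal abs x y.
Proof.
move=> hx hy; have r1 := resultant_le1.
have r2 : 0 < r ^ 2 by apply: pow_lt.
have ir : 1 <= / r ^ 2 by rewrite -Rinv_1; apply: Rinv_le_contravar => //; nra.
have hPx := nzPsi hx; have hPy := nzPsi hy.
case: (chordal_cases Habs hx hy) => [ge1|[i [xi yi h]]].
  by apply: Rle_trans (chordal_le1 Habs hPx hPy) _; nra.
have close := normalize_unit_close hx hy xi yi h.
have [xi0 lex] := normalized_le1 hx xi; have [yi0 ley] := normalized_le1 hy yi.
have unit1 (z : vec K N) : z i <> 0%R -> normalize z i i = 1%R.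
  by move=> /eqP zi0; rewrite /normalize divff.
have nz (z : vec K N) : z i <> 0%R -> nonzero_vec (normalize z i).
  by move=> zi0; exists i; rewrite unit1 ?oner_neq0.
have hx' := nzPsi (nz x xi0); have hy' := nzPsi (nz y yi0).
have pw (c : K) : c <> 0%R -> (c ^+ d)%R <> 0%R by move=> /eqP c0; apply/eqP; rewrite expf_neq0.
rewrite (chordal_scale Habs (pw _ xi0) (pw _ yi0) hx' hy' (heval_normalize xi0) (heval_normalize yi0)).
have c0 := chordal_ge0 Habs hx hy.
have rx := resultant_le_heval lex (unit1 x xi0); have ry := resultant_le_heval ley (unit1 y yi0).
rewrite -/(normalize x i) in rx; rewrite -/(normalize y i) in ry.
apply: chordal_le => //; first by apply: Rmult_le_pos => //; lra.
move=> j k; apply: Rle_trans (_ : chordal abs x y <= _); last first.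
  have rr : r ^ 2 <= norm (heval Psi (normalize x i)) * norm (heval Psi (normalize y i)).
    by rewrite /= Rmult_1_r; apply: Rmult_le_compat; lra.
  have e : / r ^ 2 * chordal abs x y * r ^ 2 = chordal abs x y by field; lra.
  rewrite -[X in X <= _]e; apply: Rmult_le_compat_l rr.
  by apply: Rmult_le_pos; lra.
set A := heval Psi (normalize x i); set B := heval Psi (normalize y i).
have -> : (A j * B k - A k * B j = A j * (B k - A k) + A k * (A j - B j))%R.
  by rewrite !mulrBr addrA [X in (_ - X + _)%R]mulrC subrK.
have [aj [bj cj]] := close j; have [ak [bk ck]] := close k.
rewrite (abs_subC Habs) in ck.
by apply: (abs_add_le Habs); rewrite (absM Habs) -[X in _ <= X]Rmult_1_l;
  apply: Rmult_le_compat => //; apply: abs_ge0 Habs _.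
Qed.

End MinimalLift.

(** * The Hölder estimate for a telescoping sequence *)

Lemma least_nat (P : nat -> Prop) : (exists n, P n) ->
  exists n, P n /\ forall k, (k < n)%N -> ~ P k.
Proof.
move=> [n Pn]; apply: NNPP => no; suff h : forall m k, (k <= m)%N -> ~ P k by exact: (h n n).
elim=> [|m IH] k; rewrite ?leqn0; first by move=> /eqP -> P0; apply: no; exists 0%N.
by move=> km Pk; apply: no; exists k; split=> // j jk; apply: IH; rewrite -ltnS (leq_trans jk).
Qed.

(* The increments of B vanish until delta reaches r, at some time n0; by then
   delta 0 >= r^(2 n0 + 1) >= u^-(n0 + 1), and the remaining increments form a
   geometric series of size O(D^-(n0 + 1)). *)
Lemma telescoping_holder (D r : R) (B delta : nat -> R) :
  2 <= D -> 0 < r <= 1 ->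
  (forall n, delta n.+1 <= / r ^ 2 * delta n) ->
  (forall n, delta n < r -> B n.+1 = B n) ->
  (forall n, Rabs (B n.+1 - B n) <= - ln r / D ^ n.+1) ->
  let u := Rmax (2 * D) (/ r ^ 2) in
  forall n, Rabs (B n - B 0%N) <=
    2 * u * ln u / D * rpow (delta 0%N) (ln D / ln u).
Proof.
move=> D2 [r0 r1] step const incr u n.
have uD : 2 * D <= u by apply: Rmax_l.
have ur : / r ^ 2 <= u by apply: Rmax_r.
have r2 : 0 < r ^ 2 by apply: pow_lt.
have lnu : 0 < ln u by rewrite -ln_1; apply: ln_increasing; lra.
have C0 : 0 < 2 * u * ln u / D.
  by apply: Rmult_lt_0_compat; [apply: Rmult_lt_0_compat; lra | apply: Rinv_0_lt_compat; lra].
have rpow_ge0 a b : 0 <= rpow a b.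
  rewrite /rpow; case: (Req_EM_T a 0) => ? /=; [exact: Rle_refl | exact/Rlt_le/exp_pos].
case: (classic (exists k, r <= delta k)) => [/least_nat [n0 [hn0 before]]|never]; last first.
  have -> : B n = B 0%N.
    elim: n => // n IH; rewrite const //.
    by apply: Rnot_le_lt => h; apply: never; exists n.
  rewrite Rminus_diag Rabs_R0; apply: Rmult_le_pos => //; lra.
have B_const k : (k <= n0)%N -> B k = B 0%N.
  elim: k => // k IH kn; rewrite const; first by apply: IH; apply: ltnW.
  exact/Rnot_le_lt/before.
have L0 : 0 <= - ln r.
  have : ln r <= ln 1 by case: (Rle_lt_or_eq_dec _ _ r1) => [lt|->]; [apply/Rlt_le/ln_increasing | lra].
  rewrite ln_1; lra.
have Lu : 2 * (- ln r) <= ln u.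
  have -> : 2 * (- ln r) = ln (/ r ^ 2).
    rewrite ln_Rinv // /= Rmult_1_r ln_mult //; lra.
  have p : 0 < / r ^ 2 by apply: Rinv_0_lt_compat.
  by case: (Rle_lt_or_eq_dec _ _ ur) => [lt|->]; [apply/Rlt_le/ln_increasing | lra].
have Dk k : 0 < / D ^ k by apply/Rinv_0_lt_compat/pow_lt; lra.
have DS k : / D ^ k.+1 = / D * / D ^ k by rewrite /= Rinv_mult.
have Di : 0 < / D <= / 2 by split; [apply: Rinv_0_lt_compat | apply: Rinv_le_contravar]; lra.
(* The factor 2 bounds 1/(1 - 1/D) for D >= 2; keeping the subtracted power lets the induction
   close. *)
have tail k : Rabs (B (n0 + k)%N - B n0) <= 2 * - ln r * / D * (/ D ^ n0 - / D ^ (n0 + k)).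
  elim: k => [|k IH].
    rewrite addn0 !Rminus_diag Rabs_R0; lra.
  have -> : B (n0 + k.+1)%N - B n0 = (B (n0 + k).+1 - B (n0 + k)%N) + (B (n0 + k)%N - B n0).
    by rewrite addnS; ring.
  apply: Rle_trans (Rabs_triang _ _) _; apply: Rle_trans (Rplus_le_compat _ _ _ _ (incr _) IH) _.
  rewrite addnS /Rdiv DS; move: (Dk (n0 + k)%N) => p.
  have q : - ln r * / D * / D ^ (n0 + k) * (2 * / D - 1) <= 0.
    have : 0 <= - ln r * / D * / D ^ (n0 + k).
      by apply: Rmult_le_pos; [apply: Rmult_le_pos|]; lra.
    nra.
  nra.
have delta_growth k : delta k <= (/ r ^ 2) ^ k * delta 0%N.
  elim: k => [|k IH] /=; first lra.
  apply: Rle_trans (step k) _; rewrite Rmult_assoc; apply: Rmult_le_compat_l => //.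
  by apply/Rlt_le/Rinv_0_lt_compat.
have delta0 : (/ u) ^ n0.+1 <= delta 0%N.
  have h := Rle_trans _ _ _ hn0 (delta_growth n0).
  have p : 0 < (/ r ^ 2) ^ n0 by apply/pow_lt/Rinv_0_lt_compat.
  have e : (r ^ 2) ^ n0 * (/ r ^ 2) ^ n0 = 1.
    by rewrite -Rpow_mult_distr Rinv_r ?pow1; lra.
  have p' : 0 < (r ^ 2) ^ n0 by apply: pow_lt.
  have iu : / u <= r ^ 2.
    by rewrite -(Rinv_inv (r ^ 2)); apply: Rinv_le_contravar => //; apply: Rinv_0_lt_compat.
  have iu0 : 0 < / u by apply: Rinv_0_lt_compat; lra.
  have h1 : (/ u) ^ n0.+1 <= (r ^ 2) ^ n0.+1 by apply: pow_incr; lra.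
  apply: Rle_trans h1 _; rewrite -tech_pow_Rmult.
  have rr : r ^ 2 <= r by rewrite /=; nra.
  have h2 : (r ^ 2) ^ n0 * r <= delta 0%N.
    have := Rmult_le_compat_l _ _ _ (Rlt_le _ _ p') h.
    by rewrite -Rmult_assoc e Rmult_1_l.
  nra.
have iu0 : 0 < / u by apply: Rinv_0_lt_compat; lra.
(* The exponent ln D / ln u is the one that turns u^-(n0 + 1) into D^-(n0 + 1). *)
have pw : / D ^ n0.+1 <= rpow (delta 0%N) (ln D / ln u).
  have d0 : 0 < delta 0%N by apply: Rlt_le_trans delta0; apply: pow_lt.
  rewrite /rpow; case: (Req_EM_T (delta 0%N) 0) => [e|?] /=; first lra.
  have lnD : 0 < ln D by rewrite -ln_1; apply: ln_increasing; lra.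
  have -> : / D ^ n0.+1 = Rpower ((/ u) ^ n0.+1) (ln D / ln u).
    rewrite /Rpower ln_pow // ln_Rinv; last lra.
    have -> : ln D / ln u * (INR n0.+1 * - ln u) = - (INR n0.+1 * ln D) by field; lra.
    by rewrite exp_Ropp -ln_pow ?exp_ln //; [apply: pow_lt|]; lra.
  apply: Rle_Rpower_l; first by apply/Rlt_le/Rdiv_lt_0_compat.
  by split=> //; apply: pow_lt.
apply: Rle_trans (_ : 2 * u * ln u / D * / D ^ n0.+1 <= _); last by apply: Rmult_le_compat_l => //; lra.
case: (leqP n n0) => [/B_const ->|/ltnW n0n].
  rewrite Rminus_diag Rabs_R0; apply: Rmult_le_pos; [lra | exact/Rlt_le].
rewrite -(B_const n0 (leqnn _)) -(subnKC n0n); apply: Rle_trans (tail _) _.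
have := Dk (n0 + (n - n0))%N; have := Dk n0 => p q.
(* [Lu] absorbs 2 (- ln r) into ln u. What is left amounts to ln u <= 2 u ln u / D, which follows
   from u >= 2 D. *)
apply: Rle_trans (_ : ln u * / D * / D ^ n0 <= _).
  apply: Rle_trans (_ : 2 * - ln r * / D * / D ^ n0 <= _).
    by apply: Rmult_le_compat_l; [apply: Rmult_le_pos | ]; lra.
  apply: Rmult_le_compat_r; first lra.
  by apply: Rmult_le_compat_r; lra.
rewrite DS /Rdiv -!Rmult_assoc; apply: Rmult_le_compat_r; first lra.
have uD1 : 2 <= u * / D.
  by apply: (Rmult_le_reg_r D); [lra | rewrite Rmult_assoc Rinv_l; lra].
have : 0 < ln u * / D by apply: Rmult_lt_0_compat; lra.
nra.
Qed.

Lemma cv_const_mult_le (a : nat -> R) l b c : Un_cv a l ->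
  (forall n, Rabs (a n - b) <= c) -> Rabs (l - b) <= c.
Proof.
move=> cv h; apply: Rnot_lt_le => lt.
have [n0 hn] := cv (Rabs (l - b) - c) ltac:(lra).
have := hn n0 (le_n _); rewrite /Rdist => h1; have := h n0.
have := Rabs_triang (l - a n0) (a n0 - b); rewrite (Rabs_minus_sym l (a n0)).
have -> : l - a n0 + (a n0 - b) = l - b by ring.
lra.
Qed.

(** * Hölder continuity of the modified Green function *)

Theorem theorem17 (K : closedFieldType) (abs : K -> R)
  (Habs : nonarch_abs abs) (Hnt : nontrivial_abs abs) (Hcomp : complete_abs abs)
  (N d : nat) (Hd : (2 <= d)%N)
  (Phi : hmap K N d) (HPhi : no_common_zero Phi)
  (Rz : {mpoly int[ncoef N d]}) (HRz : is_macaulay_resultant Rz)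
  (Phimin : hmap K N d) (Hmin : is_minimal_lift abs Phi Phimin)
  (x y : vec K N) (hx : nonzero_vec x) (hy : nonzero_vec y)
  (Gx Gy : R)
  (HGx : Un_cv (fun n => ln (vnorm abs (iter n (heval Phi) x)) / INR d ^ n) Gx)
  (HGy : Un_cv (fun n => ln (vnorm abs (iter n (heval Phi) y)) / INR d ^ n) Gy) :
  let u := Rmax (2 * INR d) (/ (abs (res_of Rz Phimin)) ^ 2) in
  let ghat_x := Gx - ln (vnorm abs x) in
  let ghat_y := Gy - ln (vnorm abs y) in
  Rabs (ghat_x - ghat_y) <=
     2 * u * ln u / INR d * rpow (chordal abs x y) (ln (INR d) / ln u).
Proof.
rewrite /res_of ev_map_mpoly; set r := abs (ev _ _).
set u := Rmax _ _; set ghat_x := Gx - _; set ghat_y := Gy - _; cbv zeta.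
have [lift hnorm1] := Hmin; have [nzmin _] := lift.
(* The iterates are those of [Phi], the estimates those of [Phimin]. The factor c shifts all log
   norms equally, so it cancels in differences, and the chordal distance ignores it. *)
have [c /eqP c0 hc] := lifts_proportional HPhi lift.
have le1 j m : abs (Phimin j m) <= 1.
  rewrite -hnorm1; exact: (foldr_Rmax_ge (fun im : 'I_N.+1 * mon N d => abs (Phimin im.1 im.2)) (j, m)).
have unc := not_countable Habs Hnt Hcomp.
have r0 : 0 < r by apply: (abs_gt0 Habs); apply: (resultant_neq0 unc HRz nzmin).
have shift i0 (z : vec K N) : z i0 = 1%R -> ev (coefvec (zero_shift i0 Phimin z)) Rz = 0%R.
  move=> zi; apply: (@resultant_zero_shift N d i0 Rz _ K Phimin z zi) => H w hw hH.
  rewrite -ev_map_mpoly; have [_ [_ hR]] := HRz; apply/(hR H); by exists w.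
have r1 : r <= 1 := resultant_le1 Habs Rz le1.
pose X n := iter n (heval Phi) x; pose Y n := iter n (heval Phi) y.
have nzX n : nonzero_vec (X n) by elim: n => //= n IH; apply: HPhi.
have nzY n : nonzero_vec (Y n) by elim: n => //= n IH; apply: HPhi.
have D2 : 2 <= INR d by apply: (le_INR 2); apply/leP.
pose lX n := ln (vnorm abs (X n)); pose lY n := ln (vnorm abs (Y n)).
(* [B] converges to [Gx - Gy] and starts at log |x| - log |y|, so its total variation from 0 to the
   limit is [ghat_x - ghat_y]. *)
pose B n := (lX n - lY n) / INR d ^ n.
pose delta n := chordal abs (X n) (Y n).
have gamma0 : 0 < abs c := abs_gt0 Habs c0.
have normS (z : vec K N) : nonzero_vec z ->
    ln (vnorm abs (heval Phimin z)) = ln (abs c) + ln (vnorm abs (heval Phi z)).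
  move=> hz; rewrite (norm_scale Habs (hc z hz)) ln_mult //.
  exact: (norm_gt0 Habs (HPhi _ hz)).
have Dpos n : 0 < INR d ^ n by apply: pow_lt; lra.
have bounds (z : vec K N) : nonzero_vec z ->
    ln r + INR d * ln (vnorm abs z) <= ln (vnorm abs (heval Phimin z)) <= INR d * ln (vnorm abs z).
  move=> hz; have z0 := norm_gt0 Habs hz.
  have [b1 b2] := norm_heval_bounds Habs le1 shift hz.
  rewrite -ln_pow // -ln_mult //; last exact: pow_lt.
  have P0 := norm_gt0 Habs (nzmin _ hz).
  have ln_le a b : 0 < a -> a <= b -> ln a <= ln b.
    by move=> a0 ab; case: (Rle_lt_or_eq_dec _ _ ab) => [lt|->]; [apply/Rlt_le/ln_increasing | apply: Rle_refl].
  by split; apply: ln_le => //; apply: Rmult_lt_0_compat => //; apply: pow_lt.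
have Bdiff n : B n.+1 - B n = (lX n.+1 - lY n.+1 - INR d * (lX n - lY n)) / INR d ^ n.+1.
  by rewrite /B /=; field; split; apply: Rgt_not_eq; [apply: Dpos | lra].
have key : forall n, Rabs (B n - B 0%N) <=
    2 * u * ln u / INR d * rpow (delta 0%N) (ln (INR d) / ln u).
  apply: telescoping_holder => //.
  - move=> n; have := chordal_heval_le Habs le1 nzmin shift r0 (nzX n) (nzY n).
    by rewrite (chordal_scale Habs c0 c0 (HPhi _ (nzX n)) (HPhi _ (nzY n)) (hc _ (nzX n)) (hc _ (nzY n))).
  - move=> n lt; have := norm_heval_locally_constant Habs le1 shift (nzX n) (nzY n) lt.
    move=> /(congr1 ln).
    have X0 := norm_gt0 Habs (nzX n); have Y0 := norm_gt0 Habs (nzY n).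
    have PX0 := norm_gt0 Habs (nzmin _ (nzX n)); have PY0 := norm_gt0 Habs (nzmin _ (nzY n)).
    rewrite !ln_mult ?ln_pow //; try exact: pow_lt.
    rewrite !normS // -/(X n.+1) -/(Y n.+1) -/(lX n.+1) -/(lY n.+1) -/(lX n) -/(lY n) => e.
    apply: Rminus_diag_uniq; rewrite Bdiff.
    have -> : lX n.+1 - lY n.+1 - INR d * (lX n - lY n) = 0 by lra.
    by rewrite /Rdiv Rmult_0_l.
  - move=> n; rewrite Bdiff Rabs_mult Rabs_inv (Rabs_pos_eq (INR d ^ n.+1)); last exact/Rlt_le.
    apply: Rmult_le_compat_r; first exact/Rlt_le/Rinv_0_lt_compat.
    (* For both points log |Phimin(z)| - d log |z| lies in [ln r, 0], so the two differ by at most -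
       ln r. *)
    have := bounds _ (nzX n); have := bounds _ (nzY n).
    rewrite !normS // -/(X n.+1) -/(Y n.+1) -/(lX n.+1) -/(lY n.+1) -/(lX n) -/(lY n).
    by move=> hY' hX'; apply: Rabs_le; lra.
have cvB : Un_cv B (Gx - Gy).
  apply: Un_cv_ext (CV_minus _ _ _ _ HGx HGy) => n.
  by rewrite /B /lX /lY /X /Y; field; apply/Rgt_not_eq.
have := cv_const_mult_le cvB key.
have -> : Gx - Gy - B 0%N = ghat_x - ghat_y.
  by rewrite /B /ghat_x /ghat_y /lX /lY /X /Y /=; field.
by [].
Qed.
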